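(* There exist absolute constants $c_1,c_2>0$ such that the following holds. Let $(X,\xi)$ be a pair of random variables with $X\sim\mu$ taking values in $\Omega$ and $\xi\in L_{\psi_2}$ real valued ($\xi$ need not be independent of $X$), and let $(X_i,\xi_i)_{i=1}^N$ be independent copies of $(X,\xi)$. Let $F$ be a class of functions on $(\Omega,\mu)$ and $s_0\ge0$ an integer. Then for every $u,w\ge8$, with probability at least $1-2\exp(-c_1u^22^{s_0})-2\exp(-c_1Nw^2)$, $$\sup_{f\in F}\left|\sum_{i=1}^N\big(\xi_if(X_i)-\mathbb E\,\xi f(X)\big)\right|\le c_2\,u\,w\,\sqrt N\,\|\xi\|_{\psi_2}\,\tilde\Lambda_{s_0,u}(F).$$
   Context: $\|\xi\|_{\psi_2}=\inf\{c>0:\mathbb E\exp(|\xi/c|^2)\le2\}$. Admissible sequence: subsets $(F_s)_{s\ge0}$ of $F$ with $|F_0|=1$, $|F_s|\le2^{2^s}$. For a random variable $Z$ and $p\ge1$, $\|Z\|_{(p)}=\sup_{1\le r\le p}\|Z\|_{L_r}/\sqrt r$; norms of a function $f$ mean norms of $f(X)$. For $u\ge1$ and integer $s_0\ge0$, $$\tilde\Lambda_{s_0,u}(F)=\inf\sup_{f\in F}\Big(\sum_{s\ge s_0}2^{s/2}\|f-\pi_sf\|_{(u^22^s)}+2^{s_0/2}\|\pi_{s_0}f\|_{(u^22^{s_0})}\Big),$$ infimum over admissible sequences of $F$, with $\pi_sf$ a nearest point to $f$ in $F_s$ w.r.t. $\|\cdot\|_{(u^22^s)}$. Suprema over $F$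 are understood over countable subclasses. *)

(* Defs.v *)
From HB Require Import structures.
From mathcomp Require Import all_boot all_order all_algebra.
From mathcomp Require Import all_classical all_reals all_analysis.
Set Implicit Arguments. Unset Strict Implicit. Unset Printing Implicit Defensive.
Import Order.TTheory GRing.Theory Num.Theory.
Local Open Scope classical_set_scope.
Local Open Scope ring_scope.

Section Defs.
Context {d : measure_display} {T : measurableType d} {R : realType}.
Variable P : probability T R.

Definition Lr (r : R) (Z : T -> R) : \bar R := Lnorm P r%:E (fun t => (Z t)%:E).

Definition pnorm (p : R) (Z : T -> R) : \bar R :=
  ereal_sup [set (Lr r Z * ((Num.sqrt r)^-1)%:E)%E | r in `[1, p]%classic].

Definition psi2 (xi : T -> R) : \bar R :=
  ereal_inf [set c%:E | c in [set c : R | 0 < c /\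
     (\int[P]_t (expR ((`|xi t| / c) ^+ 2))%:E <= 2%:E)%E]].

Definition mutually_independent {d' : measure_display} {U : measurableType d'}
    (N : nat) (Y : 'I_N -> T -> U) : Prop :=
  forall (J : {set 'I_N}) (A : 'I_N -> set U),
    (forall i, measurable (A i)) ->
    P (\bigcap_(i in [set i | i \in J]) (Y i @^-1` A i)) =
    (\prod_(i in J) P (Y i @^-1` A i))%E.

Definition same_law {d' : measure_display} {U : measurableType d'}
    (Y Z : T -> U) : Prop :=
  forall A : set U, measurable A -> P (Y @^-1` A) = P (Z @^-1` A).

Context {dO : measure_display} {Omega : measurableType dO}.

Definition fnorm (X : T -> Omega) (p : R) (h : Omega -> R) : \bar R :=
  pnorm p (h \o X).

Definition admissible_with_proj (X : T -> Omega) (u : R)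
    (F : set (Omega -> R)) (Fs : nat -> set (Omega -> R))
    (pi : nat -> (Omega -> R) -> (Omega -> R)) : Prop :=
  (forall s, Fs s `<=` F) /\
  (exists f0, Fs 0%N = [set f0]) /\
  (forall s, exists g : 'I_(2 ^ (2 ^ s)) -> (Omega -> R), Fs s `<=` range g) /\
  (forall s f, F f -> Fs s (pi s f) /\
     forall g, Fs s g ->
       (fnorm X (u ^+ 2 * 2 ^+ s) (f \- pi s f)%R <=
        fnorm X (u ^+ 2 * 2 ^+ s) (f \- g)%R)%E).

Definition LambdaT (X : T -> Omega) (s0 : nat) (u : R) (F : set (Omega -> R))
  : \bar R :=
  ereal_inf [set M | exists Fs pi, admissible_with_proj X u F Fs pi /\
    M = ereal_sup [set (\sum_(s0 <= s <oo)
                 ((Num.sqrt (2 ^+ s : R))%:E *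
                    fnorm X (u ^+ 2 * 2 ^+ s) (f \- pi s f)%R)
             + (Num.sqrt (2 ^+ s0 : R))%:E *
                    fnorm X (u ^+ 2 * 2 ^+ s0) (pi s0 f))%E
           | f in F]].

End Defs.

(* Main.v *)
Require Import Defs.
From HB Require Import structures.
From mathcomp Require Import all_boot all_order all_algebra.
From mathcomp Require Import all_classical all_reals all_analysis.
From mathcomp Require Import measurable_realfun ring lra.
Import Order.TTheory GRing.Theory Num.Theory.
Import numFieldNormedType.Exports HBNNSimple.
Local Open Scope classical_set_scope.
Local Open Scope ring_scope.

(* Chaining with moments instead of exponential moments. Put [p = u^2 2^s] and let
   [H] be the norm of [h(X)] in [(p)] and [K] the psi_2 norm of [xi]. For [2 j <= p]
   the moments obey [E xi^(2j) <= j! K^(2j)] and [E h^(2j) <= (2j)^j H^(2j)], hence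
   [E |xi h|^j <= j! (C K H)^j] by AM-GM: up to order [p] the summands look
   subexponential. With [m] close to [p / 4] there are two regimes. If [2 m <= N],
   the [2 m]-th moment of the centered sum is bounded as in Bernstein's inequality
   and Markov's inequality gives a deviation [C sqrt (N p) K H] with probability
   [1 - exp (- p)]. If [N < 2 m], Cauchy-Schwarz reduces the sum to
   [sum_i h(X_i)^2], handled by its [m]-th moment, and to [sum_i xi_i^2], which is
   at most [C N w^2 K^2] on one event of probability [1 - exp (- N w^2)] common to
   all links: this is where [w] enters. Both regimes give a bound proportional to
   [sqrt p = u 2^(s/2)], and the deviation probabilities beat the [2^(3 2^s)] links
   of level [s]. Since the infimum over admissible sequences need not be attained, the
   bound is first proved with right-hand side [y + e], and then [e] tends to [0]. *)

(** * Independence and expectation of products *)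

(** It is replaced by a recursion for the moments of a sum that never leaves the orders up to a
    fixed [q]; the series of weights in [sum_moment_le] is a truncated generating function, and
    [1 / (A tau)] stands for the Chernoff parameter. The two regimes are forced. Bernstein's
    inequality also has a subexponential term of size [p K H], which is harmless against
    [sqrt (N p) K H] only while [p] is at most of order [N]. Beyond that, Cauchy-Schwarz produces
    the factor [sqrt N] from the [xi_i] and [sqrt p] from the [h(X_i)]. A bound of order [N K^2] on
    the sum of the [xi_i^2] cannot be expected with failure probability [exp (- p)] when [p] is far
    above [N]; but it does not involve [h], so it is paid for once, outside the union bound.
    Independence is given for events only, hence product formulas for expectations are derived
    first. *)

Lemma ge0_integral_density_factor {d : measure_display} {T : measurableType d}
    {R : realType} (P : probability T R) {d' : measure_display}
    {U : measurableType d'} (Y : T -> U) (W : T -> R) (c : R) (g : U -> R) :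
  measurable_fun setT Y -> measurable_fun setT W -> (forall t, 0 <= W t) ->
  0 <= c ->
  (forall A, measurable A ->
     (\int[P]_t (W t * \1_A (Y t))%:E = c%:E * P (Y @^-1` A))%E) ->
  measurable_fun setT g -> (forall x, 0 <= g x) ->
  (\int[P]_t (W t * g (Y t))%:E = c%:E * \int[P]_t (g (Y t))%:E)%E.
Proof.
move=> mY mW W0 c0 HA mg g0.
have mEg : measurable_fun [set: U] (EFin \o g : U -> \bar R) by exact/measurable_EFinP.
(* The image under [Y] of the measure with density [W] agrees on events with [c] times the law of
   [Y]. Simple functions [h n] increasing to [g] carry this over to integrals. *)
pose h := nnsfun_approx measurableT mEg.
have hcvg x : (EFin \o h n) x @[n --> \oo] --> (g x)%:E.
  by apply: cvg_nnsfun_approx => // y _; rewrite lee_fin.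
have hnd x a b : (a <= b)%N -> h a x <= h b x.
  by move=> ab; exact/lefP/nd_nnsfun_approx.
have mhY n : measurable_fun [set: T] (fun t => h n (Y t) : R).
  exact: measurableT_comp.
have e1 : (\int[P]_t (g (Y t))%:E =
    limn (fun n => \int[P]_t (h n (Y t))%:E))%E.
  rewrite -monotone_convergence//.
  - by apply: eq_integral => t _; apply/esym/cvg_lim => //; exact: hcvg.
  - by move=> n; exact/measurable_EFinP.
  - by move=> n x _; rewrite lee_fin.
  - by move=> x _ a b ab; rewrite lee_fin hnd.
have e2 : (\int[P]_t (W t * g (Y t))%:E =
    limn (fun n => \int[P]_t (W t * h n (Y t))%:E))%E.
  rewrite -monotone_convergence//.
  - apply: eq_integral => t _; apply/esym/cvg_lim => //.
    rewrite EFinM; under eq_fun do rewrite EFinM.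
    by apply: cvgeZl => //; exact: hcvg.
  - by move=> n; apply/measurable_EFinP; exact: measurable_funM.
  - by move=> n x _; rewrite lee_fin mulr_ge0.
  - by move=> x _ a b ab; rewrite lee_fin ler_wpM2l// hnd.
suff e3 n : (\int[P]_t (W t * h n (Y t))%:E = c%:E * \int[P]_t (h n (Y t))%:E)%E.
  rewrite e2 e1; under eq_fun do rewrite e3.
  apply/cvg_lim => //; apply: cvgeZl => //.
  apply: ereal_nondecreasing_is_cvgn => a b ab.
  apply: ge0_le_integral => //; try exact/measurable_EFinP.
    by move=> x _; rewrite lee_fin.
  by move=> x _; rewrite lee_fin hnd.
have mind (r : R) : measurable_fun setT (fun t => \1_(h n @^-1` [set r]) (Y t) : R).
  by apply: measurableT_comp => //; exact: measurable_indic.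
have fin : finite_set (range (h n)) by [].
have hE t : ((h n (Y t))%:E =
    \sum_(y \in range (h n)) (y * \1_(h n @^-1` [set y]) (Y t))%:E)%E.
  by rewrite fsumEFin// -fimfunE.
have yi0 y t : 0 <= y * \1_(h n @^-1` [set y]) (Y t).
  rewrite indicE; have [hy|] := boolP (Y t \in _); last by rewrite mulr0.
  by rewrite mulr1; move: hy; rewrite inE => /= <-.
have mY1 y : measurable (Y @^-1` (h n @^-1` [set y])).
  by rewrite -[X in measurable X]setTI; apply: mY.
have y0P y : (0 <= y%:E * P (Y @^-1` (h n @^-1` [set y])))%E.
  have [y0|y0] := leP 0 y; first by rewrite mule_ge0.
  suff -> : Y @^-1` (h n @^-1` [set y]) = set0 by rewrite measure0 mule0.
  rewrite -subset0 => t /= hy.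
  by move: y0; rewrite -hy ltNge fun_ge0.
transitivity (\sum_(y \in range (h n))
    (c%:E * (y%:E * P (Y @^-1` (h n @^-1` [set y])))))%E.
  transitivity (\int[P]_t \sum_(y \in range (h n))
      (y * (W t * \1_(h n @^-1` [set y]) (Y t)))%:E)%E.
    apply: eq_integral => t _.
    rewrite EFinM hE ge0_mule_fsumr; last by move=> y; rewrite lee_fin.
    by apply: eq_fsbigr => y _; rewrite -EFinM mulrCA.
  rewrite ge0_integral_fsum//.
  - apply: eq_fsbigr => y; rewrite inE => -[x _ xy].
    have y0 : 0 <= y by rewrite -xy.
    rewrite muleCA -HA//.
    rewrite -ge0_integralZl//.
    + by apply/measurable_EFinP; exact: measurable_funM.
    + by move=> t _; rewrite lee_fin mulr_ge0.
  - by move=> y; apply/measurable_EFinP; do 2 apply: measurable_funM => //.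
  - by move=> y t _; rewrite lee_fin mulrCA mulr_ge0.
rewrite -ge0_mule_fsumr//; congr (_ * _)%E; apply/esym.
under eq_integral => t _ do rewrite hE.
rewrite ge0_integral_fsum//.
- apply: eq_fsbigr => y; rewrite inE => -[x _ xy].
  have y0 : 0 <= y by rewrite -xy.
  under eq_integral do rewrite EFinM.
  rewrite ge0_integralZl//.
  + congr (_ * _)%E.
    transitivity (\int[P]_t ((\1_(Y @^-1` (h n @^-1` [set y])) t : R)%:E))%E; first by [].
    by rewrite integral_indic ?setIT.
  + exact/measurable_EFinP.
- by move=> y; apply/measurable_EFinP; apply: measurable_funM => //.
- by move=> y t _; rewrite lee_fin.
Qed.

Lemma ge0_integral_prod_indep {d : measure_display} {T : measurableType d}
    {R : realType} (P : probability T R) {d' : measure_display}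
    {U : measurableType d'} (N : nat) (Y : 'I_N -> T -> U) (g : 'I_N -> U -> R) :
  (forall i, measurable_fun setT (Y i)) -> mutually_independent P Y ->
  (forall i, measurable_fun setT (g i)) -> (forall i x, 0 <= g i x) ->
  (forall i, (\int[P]_t (g i (Y i t))%:E < +oo)%E) ->
  (\int[P]_t (\prod_i g i (Y i t))%:E)%E = (\prod_i \int[P]_t g i (Y i t))%:E.
Proof.
move=> mY indY.
(* Below index [n] the factors are arbitrary, from [n] on they are indicators: [n = 0] is the
   definition of independence and [n = N] is the claim. *)
suff H n : (n <= N)%N -> forall g : 'I_N -> U -> R,
    (forall i, measurable_fun setT (g i)) -> (forall i x, 0 <= g i x) ->
    (forall i, (\int[P]_t (g i (Y i t))%:E < +oo)%E) ->
    (forall i : 'I_N, (n <= i)%N -> exists A, measurable A /\ g i = \1_A) ->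
    (\int[P]_t (\prod_i g i (Y i t))%:E)%E = (\prod_i \int[P]_t g i (Y i t))%:E.
  move=> mg g0 goo; apply: (H N) => // i; by rewrite leqNgt ltn_ord.
have mpre i A : measurable A -> measurable (Y i @^-1` A).
  by move=> mA; rewrite -[X in measurable X]setTI; apply: mY.
elim: n => [_ {}g mg g0 goo /(_ _ (leq0n _)) gA|n IH nN {}g mg g0 goo gA].
  have /choice[A hA] i : exists A, measurable A /\ g i = \1_A by exact: gA.
  have mA i : measurable (A i) by case: (hA i).
  have gE i x : g i x = \1_(A i) x by case: (hA i) => _ ->.
  pose B := \bigcap_(i in [set i | i \in [set: 'I_N]%SET]) (Y i @^-1` A i).
  have mB : measurable B by apply: fin_bigcap_measurable => // i _; exact: mpre.
  transitivity (\int[P]_t (\1_B t)%:E)%E.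
    apply: eq_integral => t _; congr (_%:E); rewrite indicE.
    have [Bt|Bt] := boolP (t \in B).
      rewrite big1// => i _; rewrite gE indicE mem_set//.
      by move: Bt; rewrite inE => /(_ i); apply; rewrite /= finset.in_setT.
    have [i Ai] : exists i, ~ A i (Y i t).
      apply: contrapT => /forallNP/= AY; move: Bt; rewrite notin_setE; apply=> i _.
      by apply: contrapT; exact: AY.
    by rewrite (bigD1 i)//= gE indicE memNset// mul0r.
  rewrite integral_indic// setIT [LHS](indY [set: 'I_N]%SET A mA) -prodEFin.
  rewrite big_mkcond/=.
  apply: eq_bigr => i _; rewrite finset.in_setT.
  rewrite /Rintegral.
  under eq_integral => t _ do rewrite gE.
  transitivity (\int[P]_t ((\1_(Y i @^-1` A i) t : R)%:E))%E; last first.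
    rewrite fineK//.
    rewrite integral_indic ?setIT// ?fin_num_measure//; exact: mpre.
  by rewrite integral_indic ?setIT//; exact: mpre.
pose i0 := Ordinal nN.
rewrite (bigD1 i0)//= EFinM muleC.
have Rge0 i : 0 <= \int[P]_t g i (Y i t) by apply: Rintegral_ge0.
under eq_integral => t _ do rewrite (bigD1 i0)//= mulrC.
have gfin i : ((\int[P]_t g i (Y i t))%:E = \int[P]_t (g i (Y i t))%:E)%E.
  by rewrite fineK// ge0_fin_numE// integral_ge0// => t _; rewrite lee_fin.
rewrite [X in (_ * X)%E]gfin.
apply: (@ge0_integral_density_factor _ _ _ P _ _ (Y i0)
  (fun t => \prod_(i < N | i != i0) g i (Y i t))) => //.
- under [X in measurable_fun _ X]eq_fun do rewrite big_mkcond/=.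
  by apply: measurable_prod => i _; case: (i != i0) => //; exact: measurableT_comp.
- by move=> t; apply: prodr_ge0.
- by apply: prodr_ge0.
move=> A mA.
(* With an indicator in place [i0] the induction hypothesis applies; this is exactly the test on
   events that lets [ge0_integral_density_factor] restore the factor [g i0]. *)
pose gA' i := if i == i0 then \1_A : U -> R else g i.
have gA'E i : i != i0 -> gA' i = g i by rewrite /gA' => /negPf ->.
have gA'0 : gA' i0 = \1_A by rewrite /gA' eqxx.
have PA : (\int[P]_t ((\1_A (Y i0 t))%:E) = P (Y i0 @^-1` A))%E.
  transitivity (\int[P]_t ((\1_(Y i0 @^-1` A) t : R)%:E))%E => //.
  by rewrite integral_indic ?setIT//; exact: mpre.
have := IH (ltnW nN) gA'.
rewrite (bigD1 i0)//= gA'0 EFinM muleC.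
under eq_integral => t _ do rewrite (bigD1 i0)//= mulrC gA'0.
rewrite [X in (_ * X)%E](_ : _ = P (Y i0 @^-1` A)); last first.
  by rewrite /Rintegral PA fineK// fin_num_measure//; exact: mpre.
rewrite [X in (X%:E * _)%E](_ : _ = \prod_(i < N | i != i0) \int[P]_t g i (Y i t)); last first.
  by apply: eq_bigr => i /gA'E ->.
move=> <-.
- by apply: eq_integral => t _; congr (_ * _)%:E; apply: eq_bigr => i /gA'E ->.
- by move=> i; rewrite /gA'; case: ifP => // _; exact: measurable_indic.
- by move=> i x; rewrite /gA'; case: ifP.
- move=> i; have [->|/gA'E ->//] := eqVneq i i0.
  by rewrite gA'0 PA ltey_eq fin_num_measure//; exact: mpre.
- move=> i ni; have [->|ii0] := eqVneq i i0; first by exists A; split.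
  rewrite gA'E//; apply: gA; rewrite ltn_neqAle ni andbT.
  by apply: contra ii0 => /eqP e; apply/eqP/val_inj.
Qed.

Lemma integral_prod_indep {d : measure_display} {T : measurableType d}
    {R : realType} (P : probability T R) {d' : measure_display}
    {U : measurableType d'} (N : nat) (Y : 'I_N -> T -> U) (g : 'I_N -> U -> R) :
  (forall i, measurable_fun setT (Y i)) -> mutually_independent P Y ->
  (forall i, measurable_fun setT (g i)) ->
  (forall i, P.-integrable setT (fun t => (g i (Y i t))%:E)) ->
  P.-integrable setT (fun t => (\prod_i g i (Y i t))%:E) /\
  \int[P]_t (\prod_i g i (Y i t)) = \prod_i \int[P]_t g i (Y i t).
Proof.
move=> mY indY mg ig.
have int_prod (h : 'I_N -> U -> R) : (forall i, measurable_fun setT (h i)) ->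
    (forall i, P.-integrable setT (fun t => (h i (Y i t))%:E)) ->
    P.-integrable setT (fun t => (\prod_i h i (Y i t))%:E).
  move=> mh ih; apply/integrableP; split.
    by apply/measurable_EFinP; apply: measurable_prod => i _; apply: measurableT_comp.
  under eq_integral => t _ do rewrite abse_EFin normr_prod.
  rewrite (@ge0_integral_prod_indep _ _ _ _ _ _ _ _ (fun i x => `|h i x|)) ?ltry//.
  - by move=> i; apply: measurableT_comp.
  - by move=> i; have /integrableP[] := ih i.
split; first exact: int_prod.
(* Here [n] bounds the indices whose factor may change sign. Splitting one such factor into its
   positive and negative parts lowers [n] by one. *)
suff H n : (n <= N)%N -> forall g : 'I_N -> U -> R,
    (forall i, measurable_fun setT (g i)) ->
    (forall i, P.-integrable setT (fun t => (g i (Y i t))%:E)) ->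
    (forall i : 'I_N, (n <= i)%N -> forall x, 0 <= g i x) ->
    \int[P]_t (\prod_i g i (Y i t)) = \prod_i \int[P]_t g i (Y i t).
  by apply: (H N) => // i; rewrite leqNgt ltn_ord.
elim: n => [_ {}g {}mg {}ig g0|n IH nN {}g {}mg {}ig g0].
  rewrite {1}/Rintegral ge0_integral_prod_indep//.
  - by move=> i x; exact: g0.
  - move=> i; have /integrableP[_] := ig i; apply: le_lt_trans.
    apply: ge0_le_integral => //.
    + by move=> t _; rewrite lee_fin g0.
    + by apply/measurable_EFinP; exact: measurableT_comp.
    + by apply: measurableT_comp => //; apply/measurable_EFinP; exact: measurableT_comp.
    + by move=> t _; rewrite lee_fin ler_norm.
pose i0 := Ordinal nN.
pose upd (h : U -> R) i := if i == i0 then h else g i.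
have updE h i : i != i0 -> upd h i = g i by rewrite /upd => /negPf ->.
have upd0 h : upd h i0 = h by rewrite /upd eqxx.
have step (h : U -> R) : measurable_fun setT h -> (forall x, 0 <= h x) ->
    P.-integrable setT (fun t => (h (Y i0 t))%:E) ->
    P.-integrable setT (fun t => (h (Y i0 t) * \prod_(i < N | i != i0) g i (Y i t))%:E) /\
    \int[P]_t (h (Y i0 t) * \prod_(i < N | i != i0) g i (Y i t)) =
    \int[P]_t (h (Y i0 t)) * \prod_(i < N | i != i0) \int[P]_t g i (Y i t).
  move=> mh h0 ih.
  have mu i : measurable_fun setT (upd h i) by rewrite /upd; case: ifP.
  have iu i : P.-integrable setT (fun t => (upd h i (Y i t))%:E).
    by have [->|/updE ->//] := eqVneq i i0; rewrite upd0.
  have E t : \prod_i upd h i (Y i t) = h (Y i0 t) * \prod_(i < N | i != i0) g i (Y i t).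
    by rewrite (bigD1 i0)//= upd0; congr (_ * _); apply: eq_bigr => i /updE ->.
  split.
    have := int_prod _ mu iu; apply: eq_integrable => // t _; by rewrite E.
  have := IH (ltnW nN) (upd h) mu iu.
  under eq_Rintegral => t _ do rewrite E.
  move=> ->.
    by rewrite (bigD1 i0)//= upd0; congr (_ * _); apply: eq_bigr => i /updE ->.
  move=> i ni x; have [->|ii0] := eqVneq i i0; first by rewrite upd0.
  rewrite updE//; apply: g0; rewrite ltn_neqAle ni andbT.
  by apply: contra ii0 => /eqP e; apply/eqP/val_inj.
pose gp x := Num.max (g i0 x) 0.
pose gn x := Num.max (- g i0 x) 0.
have gpn x : g i0 x = gp x - gn x.
  by rewrite /gp /gn; case: (lerP (g i0 x)) => ?; case: (lerP (- g i0 x)) => ?; lra.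
have mgp : measurable_fun setT gp by apply: measurable_maxr.
have mgn : measurable_fun setT gn.
  by apply: measurable_maxr => //; exact: measurableT_comp.
have igp : P.-integrable setT (fun t => (gp (Y i0 t))%:E).
  apply: le_integrable (ig i0) => //.
    by apply/measurable_EFinP; exact: measurableT_comp.
  move=> t _; rewrite lee_fin /gp; case: (lerP (g i0 (Y i0 t)) 0) => // _.
  by rewrite normr0.
have ign : P.-integrable setT (fun t => (gn (Y i0 t))%:E).
  apply: le_integrable (ig i0) => //.
    by apply/measurable_EFinP; exact: measurableT_comp.
  move=> t _; rewrite lee_fin /gn; case: (lerP (- g i0 (Y i0 t)) 0) => // _.
    by rewrite normr0.
  by rewrite normrN.
have gp0 x : 0 <= gp x by rewrite le_max lexx orbT.
have gn0 x : 0 <= gn x by rewrite le_max lexx orbT.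
have [ip ep] := step _ mgp gp0 igp.
have [in' en] := step _ mgn gn0 ign.
rewrite (bigD1 i0)//=.
under eq_Rintegral => t _ do rewrite (bigD1 i0)//= gpn mulrBl.
rewrite RintegralB// ep en -mulrBl; congr (_ * _).
rewrite -RintegralB//; apply: eq_Rintegral => t _; by rewrite gpn.
Qed.

(** * Moments of sums of independent variables *)

Lemma integrable_Rintegral_sum {d : measure_display} {T : measurableType d}
    {R : realType} (P : probability T R) (I : Type) (s : seq I) (f : I -> T -> R) :
  (forall i, P.-integrable setT (fun t => (f i t)%:E)) ->
  P.-integrable setT (fun t => (\sum_(i <- s) f i t)%:E) /\
  \int[P]_t (\sum_(i <- s) f i t) = \sum_(i <- s) \int[P]_t f i t.
Proof.
move=> fi; elim: s => [|i s [IH1 IH2]].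
  split; first by under [X in _.-integrable _ X]eq_fun do rewrite big_nil; exact: integrable0.
  under eq_Rintegral do rewrite big_nil.
  by rewrite big_nil /Rintegral integral0.
split.
  under [X in _.-integrable _ X]eq_fun do rewrite big_cons EFinD.
  exact: integrableD.
under eq_Rintegral do rewrite big_cons.
by rewrite (RintegralD measurableT (fi i) IH1) IH2 big_cons.
Qed.

(* [sum_moment a n k] is the [k]-th moment of a sum of [n] independent variables
   whose [j]-th moment is [a j]. *)
Fixpoint sum_moment {R : pzRingType} (a : nat -> R) (n k : nat) : R :=
  if n is n'.+1 then \sum_(j < k.+1) sum_moment a n' (k - j) * a j *+ 'C(k, j)
  else (k == 0)%:R.

(* The weights [b j / tau ^ j] dominate the terms of the exponential moment
   generating function of one summand, truncated at order [q]. *)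
Lemma sum_moment_le {R : realType} (a b : nat -> R) (A tau rho : R) (q n k : nat) :
  0 <= A -> 0 < tau -> (forall j, 0 <= b j) ->
  (forall j, (j <= q)%N -> `|a j| <= j`!%:R * A ^+ j * b j) ->
  \sum_(j < q.+1) b j / tau ^+ j <= rho -> (k <= q)%N ->
  `|sum_moment a n k| <= k`!%:R * (A * tau) ^+ k * rho ^+ n.
Proof.
move=> A0 tau0 b0 ab brho.
have rho0 : 0 <= rho.
  apply: le_trans brho; apply: sumr_ge0 => j _.
  by rewrite divr_ge0// exprn_ge0// ltW.
elim: n k => [|n IH] k kq /=.
  rewrite expr0 mulr1; case: k {kq} => [|k]; first by rewrite expr0 normr1 mulr1.
  by rewrite normr0 mulr_ge0// exprn_ge0// mulr_ge0// ltW.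
apply: le_trans (ler_norm_sum _ _ _) _.
(* The factorials absorb the binomial coefficient, so each term of the recursion is the bound for
   [n] summands times the weight [b j / tau ^ j]: one more summand costs one factor [rho]. *)
apply: (@le_trans _ _ (\sum_(j < k.+1)
   (k`!%:R * (A * tau) ^+ k * rho ^+ n) * (b j / tau ^+ j))).
  apply: ler_sum => j _.
  have jk : (j <= k)%N by rewrite -ltnS.
  rewrite -mulr_natr normrM normrM normr_nat.
  have e : k`!%:R = (k - j)`!%:R * j`!%:R * 'C(k, j)%:R :> R.
    by rewrite -!natrM -(bin_fact jk); congr (_%:R); ring.
  have tauj : tau ^+ j != 0 by rewrite expf_neq0// gt_eqF.
  have -> : k`!%:R * (A * tau) ^+ k * rho ^+ n * (b j / tau ^+ j) =
    (((k - j)`!%:R * (A * tau) ^+ (k - j) * rho ^+ n) * (j`!%:R * A ^+ j * b j))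
      * 'C(k, j)%:R.
    rewrite -{2}(subnK jk) exprD e [(A * tau) ^+ j]exprMn.
    by field.
  apply: ler_wpM2r => //; apply: ler_pM => //.
    by apply: IH; exact: leq_trans (leq_subr _ _) kq.
  by apply: ab; exact: leq_trans jk kq.
rewrite -mulr_sumr exprSr mulrA.
apply: ler_wpM2l.
  by rewrite !mulr_ge0// exprn_ge0// mulr_ge0// ltW.
apply: le_trans brho.
rewrite -(subnKC kq) -addSn big_split_ord/= lerDl.
by apply: sumr_ge0 => j _; rewrite divr_ge0// exprn_ge0// ltW.
Qed.

Lemma moment_sum_indep {d : measure_display} {T : measurableType d}
    {R : realType} (P : probability T R) {d' : measure_display}
    {U : measurableType d'} (N : nat) (Y : 'I_N -> T -> U) (G : U -> R)
    (a : nat -> R) (q k : nat) :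
  (forall i, measurable_fun setT (Y i)) -> mutually_independent P Y ->
  measurable_fun setT G ->
  (forall i j, (j <= q)%N -> P.-integrable setT (fun t => (G (Y i t) ^+ j)%:E) /\
     \int[P]_t (G (Y i t) ^+ j) = a j) ->
  (k <= q)%N ->
  P.-integrable setT (fun t => ((\sum_i G (Y i t)) ^+ k)%:E) /\
  \int[P]_t ((\sum_i G (Y i t)) ^+ k) = sum_moment a N k.
Proof.
move=> mY indY mG aG kq.
(* The induction needs a mixed form: the first [n] variables are summed, the others carry fixed
   powers [kap]. The binomial theorem moves one variable from the sum to the product, and for
   [n = k = 0] only the product formula is left. *)
pose f n k (kap : 'I_N -> nat) t :=
  (\sum_(i < N | (i < n)%N) G (Y i t)) ^+ k *
  \prod_(i < N | (n <= i)%N) G (Y i t) ^+ kap i.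
suff H n : (n <= N)%N -> forall k (kap : 'I_N -> nat), (k <= q)%N ->
    (forall i, (kap i <= q)%N) ->
    P.-integrable setT (fun t => (f n k kap t)%:E) /\
    \int[P]_t (f n k kap t) = sum_moment a n k * \prod_(i < N | (n <= i)%N) a (kap i).
  have [//|] := H N (leqnn N) k (fun=> 0) kq; rewrite /f.
  have e0 (h : 'I_N -> R) : \prod_(i < N | (N <= i)%N) h i = 1.
    by rewrite big_pred0// => i; rewrite leqNgt ltn_ord.
  rewrite e0 mulr1.
  have e1 t : (\sum_(i < N | (i < N)%N) G (Y i t)) = \sum_i G (Y i t).
    by apply: eq_bigl => i; rewrite ltn_ord.
  under eq_fun do rewrite e1 e0 mulr1.
  by under eq_Rintegral do rewrite e1 e0 mulr1.
elim: n => [_|n IH nN] {}k kap {}kq kapq.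
  have e1 t : \sum_(i < N | (i < 0)%N) G (Y i t) = 0 by rewrite big_pred0.
  have [i1 i2] := @integral_prod_indep _ _ _ P _ _ N Y (fun i x => G x ^+ kap i)
    mY indY (fun i => measurable_funX (kap i) mG) (fun i => (aG i (kap i) (kapq i)).1).
  rewrite /f; case: k kq => [|k] kq.
    under eq_fun do rewrite expr0 mul1r.
    under eq_Rintegral do rewrite expr0 mul1r.
    rewrite mul1r; split => //.
    rewrite i2; apply: eq_bigr => i _; exact: (aG i _ _).2.
  under eq_fun do rewrite e1 expr0n mul0r.
  under eq_Rintegral do rewrite e1 expr0n mul0r.
  split; first exact: integrable0.
  by rewrite /= mul0r /Rintegral integral0.
pose i0 := Ordinal nN.
pose upd j (i : 'I_N) := if i == i0 then j else kap i.
have predE (i : 'I_N) : (i < n.+1)%N && (i != i0) = (i < n)%N.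
  rewrite ltnS leq_eqVlt.
  have [->|ii0] := eqVneq i i0; first by rewrite /= andbF ltnn.
  rewrite andbT; case: eqP => // e; exfalso; move/eqP: ii0; apply; exact/val_inj.
have predE' (i : 'I_N) : (n <= i)%N && (i != i0) = (n < i)%N.
  rewrite leq_eqVlt.
  have [->|ii0] := eqVneq i i0; first by rewrite /= andbF ltnn.
  rewrite andbT; case: eqP => // e; exfalso; move/eqP: ii0; apply; exact/val_inj.
have updE j (h : 'I_N -> nat -> R) :
    \prod_(i < N | (n <= i)%N) h i (upd j i) =
    h i0 j * \prod_(i < N | (n < i)%N) h i (kap i).
  rewrite (bigD1 i0)//= /upd eqxx; congr (_ * _).
  rewrite (eq_bigl _ _ predE'); apply: eq_bigr => i ni.
  by case: eqP => // ii0; move: ni; rewrite ii0 ltnn.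
have fE t : f n.+1 k kap t = \sum_(j < k.+1) 'C(k, j)%:R * f n (k - j)%N (upd j) t.
  rewrite /f (bigD1 i0)//= (eq_bigl _ _ predE) addrC exprDn mulr_suml.
  apply: eq_bigr => j _.
  rewrite (updE j (fun i m => G (Y i t) ^+ m)) -mulr_natl; ring.
have fj (j : 'I_k.+1) : P.-integrable setT (fun t => (f n (k - j)%N (upd j) t)%:E) /\
    \int[P]_t (f n (k - j)%N (upd j) t) =
    sum_moment a n (k - j)%N * (a j * \prod_(i < N | (n < i)%N) a (kap i)).
  have [||i1 ->] := IH (ltnW nN) (k - j)%N (upd j).
  - exact: leq_trans (leq_subr _ _) kq.
  - move=> i; rewrite /upd; case: ifP => // _; apply: leq_trans kq.
    by rewrite -ltnS.
  - by split => //; rewrite (updE j (fun i m => a m)).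
have fj' (j : 'I_k.+1) :
    P.-integrable setT (fun t => ('C(k, j)%:R * f n (k - j)%N (upd j) t)%:E).
  under eq_fun do rewrite EFinM.
  by apply: integrableZl => //; exact: (fj j).1.
have [j1 j2] := @integrable_Rintegral_sum _ _ _ P _ (index_enum 'I_k.+1) _ fj'.
split.
  by under eq_fun do rewrite fE.
under eq_Rintegral do rewrite fE.
rewrite j2 /= mulr_suml; apply: eq_bigr => j _.
rewrite RintegralZl//; last exact: (fj j).1.
by rewrite (fj j).2 -mulr_natl; ring.
Qed.

(** * The norms [pnorm] and [psi2] *)

Lemma same_law_integral {d : measure_display} {T : measurableType d}
    {R : realType} (P : probability T R) {d' : measure_display}
    {U : measurableType d'} (Y Z : T -> U) (f : U -> \bar R) :
  measurable_fun setT Y -> measurable_fun setT Z -> same_law P Y Z ->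
  measurable_fun setT f ->
  (\int[P]_t f (Y t) = \int[P]_t f (Z t))%E.
Proof.
move=> mY mZ YZ mf.
suff ge0 (g : U -> \bar R) : measurable_fun setT g -> (forall x, 0 <= g x)%E ->
    (\int[P]_t g (Y t) = \int[P]_t g (Z t))%E.
  rewrite [LHS]integralE [RHS]integralE; congr (_ - _)%E.
    transitivity (\int[P]_t f^\+ (Y t))%E; first by apply: eq_integral => t _; rewrite !funeposE.
    rewrite (ge0 f^\+%E (measurable_funepos mf) (fun x => funepos_ge0 f x)).
    by apply: eq_integral => t _; rewrite !funeposE.
  transitivity (\int[P]_t f^\- (Y t))%E; first by apply: eq_integral => t _; rewrite !funenegE.
  rewrite (ge0 f^\-%E (measurable_funeneg mf) (fun x => funeneg_ge0 f x)).
  by apply: eq_integral => t _; rewrite !funenegE.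
move=> mg g0.
have g0' : {in [set: U], forall y, (0 <= g y)%E} by move=> y _.
transitivity (\int[P]_(x in Y @^-1` setT) (g \o Y) x)%E => //.
transitivity (\int[P]_(x in Z @^-1` setT) (g \o Z) x)%E => //.
rewrite -(ge0_integral_pushforward mY P measurableT mg g0').
rewrite -(ge0_integral_pushforward mZ P measurableT mg g0').
by apply: eq_measure_integral => A mA _; exact: YZ.
Qed.

Section pnorm.
Context {d : measure_display} {T : measurableType d} {R : realType}.
Variable P : probability T R.
Implicit Types (p : R) (Z : T -> R).

Lemma pnorm_ge0 p Z : 1 <= p -> (0 <= pnorm P p Z)%E.
Proof.
move=> p1; apply: (@le_trans _ _ (Lr P 1 Z * ((Num.sqrt 1)^-1)%:E)%E).
  by rewrite mule_ge0 ?Lnorm_ge0// lee_fin invr_ge0 sqrtr_ge0.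
by apply: ereal_sup_ubound; exists 1 => //; rewrite /= in_itv/= lexx.
Qed.

Lemma le_pnorm p p' Z : p <= p' -> (pnorm P p Z <= pnorm P p' Z)%E.
Proof.
move=> pp'; apply: le_ereal_sup => _ [r /= rp <-]; exists r => //.
by move: rp; rewrite /= !in_itv/= => /andP[-> /le_trans]; apply.
Qed.

Lemma pnormB p Z1 Z2 : measurable_fun setT Z1 -> measurable_fun setT Z2 ->
  (pnorm P p (Z1 \- Z2)%R <= pnorm P p Z1 + pnorm P p Z2)%E.
Proof.
move=> m1 m2; apply: ub_ereal_sup => _ [r /= rp <-].
have r1 : 1 <= r by move: rp; rewrite /= in_itv/= => /andP[].
have s0 : (0 <= ((Num.sqrt r)^-1)%:E)%E by rewrite lee_fin invr_ge0 sqrtr_ge0.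
apply: (@le_trans _ _ ((Lr P r Z1 + Lr P r Z2) * ((Num.sqrt r)^-1)%:E)%E).
  apply: lee_wpmul2r => //.
  have e2 : Lr P r Z2 = Lr P r (\- Z2)%R.
    rewrite /Lr -(@oppe_Lnorm _ _ _ P (fun t => (Z2 t)%:E)).
    by apply: eq_Lnorm => t /=.
  rewrite e2.
  have := @minkowski_EFin _ _ _ P Z1 (\- Z2)%R r m1 (measurableT_comp (@oppr_measurable R setT) m2) r1.
  exact.
rewrite ge0_muleDl ?Lnorm_ge0//.
by apply: leeD; apply: ereal_sup_ubound; exists r.
Qed.

Lemma pnorm_moment p Z (H : R) j : 0 <= H -> measurable_fun setT Z ->
  (pnorm P p Z <= H%:E)%E -> (0 < j)%N -> (2 * j)%:R <= p ->
  (\int[P]_t (Z t ^+ (2 * j))%:E <= ((2 * j)%:R ^+ j * H ^+ (2 * j))%:E)%E.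
Proof.
move=> H0 mZ ZH j0 jp.
pose r : R := (2 * j)%:R.
have r0 : 0 < r by rewrite ltr0n muln_gt0.
have r1 : 1 <= r by rewrite ler1n muln_gt0.
have sr : 0 < Num.sqrt r by rewrite sqrtr_gt0.
have LH : (Lr P r Z <= (H * Num.sqrt r)%:E)%E.
  rewrite EFinM -lee_pdivrMr//.
  apply: le_trans ZH; apply: ereal_sup_ubound; exists r => //.
  by rewrite /= in_itv/= r1.
have -> : (\int[P]_t (Z t ^+ (2 * j))%:E = Lr P r Z `^ r)%E.
  rewrite poweR_Lnorm ?gt_eqF//; apply: eq_integral => t _.
  rewrite abse_EFin poweR_EFin /r powR_mulrn//.
  by rewrite -normrX ger0_norm// exprM exprn_ge0// sqr_ge0.
apply: (@le_trans _ _ ((H * Num.sqrt r)%:E `^ r)%E).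
  apply: gt0_ler_poweR => //; rewrite ?in_itv/= ?Lnorm_ge0 ?leey// ?(ltW r0)//.
  by rewrite andbT lee_fin mulr_ge0// ltW.
rewrite poweR_EFin /r powR_mulrn; last by rewrite mulr_ge0// sqrtr_ge0.
rewrite lee_fin exprMn mulrC ler_wpM2r ?exprn_ge0//.
by rewrite exprM sqr_sqrtr// ltW.
Qed.

(** One integrates [1 + x^j / j! <= exp x] at [x = (|xi| / c)^2]. The term 1 uses up half of the
    bound 2, which leaves the constant [j!] without a further factor. *)
Lemma psi2_moment (xi : T -> R) (c : R) j : 0 < c -> measurable_fun setT xi ->
  (\int[P]_t (expR ((`|xi t| / c) ^+ 2))%:E <= 2%:E)%E -> (0 < j)%N ->
  (\int[P]_t (xi t ^+ (2 * j))%:E <= (j`!%:R * c ^+ (2 * j))%:E)%E.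
Proof.
move=> c0 mxi xic; case: j => // j _.
set k := j.+1.
have f0 : 0 < k`!%:R :> R by rewrite ltr0n fact_gt0.
have C0 : 0 < k`!%:R * c ^+ (2 * k) by rewrite mulr_gt0// exprn_gt0.
have mx : measurable_fun setT (fun t => xi t ^+ (2 * k)) by exact: measurable_funX.
have x0 t : 0 <= xi t ^+ (2 * k) by rewrite exprM exprn_ge0// sqr_ge0.
have : (\int[P]_t ((k`!%:R * c ^+ (2 * k))^-1%:E * (xi t ^+ (2 * k))%:E + 1) <= 2%:E)%E.
  apply: le_trans xic; apply: ge0_le_integral => //.
  - by move=> t _; rewrite adde_ge0// mule_ge0// lee_fin// invr_ge0 ltW.
  - apply: emeasurable_funD => //; apply: emeasurable_funM => //.
    exact/measurable_EFinP.
  - apply/measurable_EFinP; apply: measurableT_comp => //.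
    by apply: measurable_funX; apply: measurable_funM => //; exact: measurableT_comp.
  - move=> t _; rewrite -EFinM -EFinD lee_fin.
    have := @expR_ge1Dxn R ((`|xi t| / c) ^+ 2) j (sqr_ge0 _).
    apply: le_trans; rewrite addrC lerD2l -exprM -/k exprMn -normrX (ger0_norm (x0 t)).
    by rewrite exprVn invfM -mulrA mulrC [_^-1 * xi t ^+ _]mulrC.
have q0 : (0 <= ((k`!%:R * c ^+ (2 * k))^-1)%:E)%E by rewrite lee_fin invr_ge0 ltW.
have q1 : measurable_fun setT (fun t => (xi t ^+ (2 * k))%:E) by exact/measurable_EFinP.
have q2 t : [set: T] t -> (0 <= (xi t ^+ (2 * k))%:E)%E by rewrite lee_fin.
have q3 t : [set: T] t ->
    (0 <= ((k`!%:R * c ^+ (2 * k))^-1)%:E * (xi t ^+ (2 * k))%:E)%E.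
  by move=> _; rewrite mule_ge0// lee_fin.
have q4 : measurable_fun setT
    (fun t => ((k`!%:R * c ^+ (2 * k))^-1)%:E * (xi t ^+ (2 * k))%:E)%E.
  exact: emeasurable_funM.
rewrite ge0_integralD// ge0_integralZl// integral_cst// mul1e.
rewrite [X in (_ + X)%E](probability_setT P).
rewrite (_ : 2%:E = 1 + 1)%E; last by rewrite -EFinD.
by rewrite leeD2rE// lee_pdivrMl// mule1.
Qed.

End pnorm.

(** A single term of the exponential series at [j]. It turns the growth [(2 j)^j] of the moments of
    [h(X)^2] into [j!] times a geometric factor. *)
Lemma expn_le_fact {R : realType} (j : nat) :
  j%:R ^+ j <= j`!%:R * expR 1 ^+ j :> R.
Proof.
case: j => [|j]; first by rewrite fact0 !expr0 mulr1.
have f0 : 0 < j.+1`!%:R :> R by rewrite ltr0n fact_gt0.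
have := @expR_ge1Dxn R j.+1%:R j (ler0n _ _).
rewrite (_ : expR j.+1%:R = expR 1 ^+ j.+1); last by rewrite -expRM_natl mulr1.
move=> h; rewrite mulrC -ler_pdivrMr//.
by apply: le_trans h; rewrite lerDr.
Qed.

Lemma integral_normM_le {d : measure_display} {T : measurableType d}
    {R : realType} (P : probability T R) (xi Z : T -> R) (K H : R) j :
  0 < K -> 0 <= H -> (0 < j)%N ->
  measurable_fun setT xi -> measurable_fun setT Z ->
  (\int[P]_t (xi t ^+ (2 * j))%:E <= (j`!%:R * K ^+ (2 * j))%:E)%E ->
  (\int[P]_t (Z t ^+ (2 * j))%:E <= ((2 * j)%:R ^+ j * H ^+ (2 * j))%:E)%E ->
  (\int[P]_t (`|xi t * Z t| ^+ j)%:E <= (j`!%:R * (2 * expR 1 * K * H) ^+ j)%:E)%E.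
Proof.
move=> K0 H0 j0 mxi mZ xiK ZH.
set a := _ * _ in xiK; set b := _ * _ in ZH.
have f0 : 0 < j`!%:R :> R by rewrite ltr0n fact_gt0.
have a0 : 0 < a by rewrite mulr_gt0// exprn_gt0.
have x0 t : 0 <= xi t ^+ (2 * j) by rewrite exprM exprn_ge0// sqr_ge0.
have z0 t : 0 <= Z t ^+ (2 * j) by rewrite exprM exprn_ge0// sqr_ge0.
have key (la : R) : 0 < la ->
    (\int[P]_t (`|xi t * Z t| ^+ j)%:E <= (la * a / 2 + b / (2 * la))%:E)%E.
  move=> l0.
  have c1 : (0 <= (la / 2)%:E)%E by rewrite lee_fin divr_ge0// ltW.
  have c2 : (0 <= ((2 * la)^-1)%:E)%E by rewrite lee_fin invr_ge0 mulr_ge0// ltW.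
  have mx : measurable_fun setT (fun t => (xi t ^+ (2 * j))%:E).
    by apply/measurable_EFinP; exact: measurable_funX.
  have mz : measurable_fun setT (fun t => (Z t ^+ (2 * j))%:E).
    by apply/measurable_EFinP; exact: measurable_funX.
  have ex0 t : [set: T] t -> (0 <= (xi t ^+ (2 * j))%:E)%E by rewrite lee_fin.
  have ez0 t : [set: T] t -> (0 <= (Z t ^+ (2 * j))%:E)%E by rewrite lee_fin.
  have cmx : measurable_fun setT (fun t => (la / 2)%:E * (xi t ^+ (2 * j))%:E)%E.
    exact: emeasurable_funM.
  have cmz : measurable_fun setT (fun t => ((2 * la)^-1)%:E * (Z t ^+ (2 * j))%:E)%E.
    exact: emeasurable_funM.
  have cx0 t : [set: T] t -> (0 <= (la / 2)%:E * (xi t ^+ (2 * j))%:E)%E.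
    by move=> tT; rewrite mule_ge0// ex0.
  have cz0 t : [set: T] t -> (0 <= ((2 * la)^-1)%:E * (Z t ^+ (2 * j))%:E)%E.
    by move=> tT; rewrite mule_ge0// ez0.
  apply: (@le_trans _ _ (\int[P]_t ((la / 2)%:E * (xi t ^+ (2 * j))%:E +
      ((2 * la)^-1)%:E * (Z t ^+ (2 * j))%:E))%E).
    apply: ge0_le_integral => //.
    - apply/measurable_EFinP; apply: measurable_funX; apply: measurableT_comp => //.
      exact: measurable_funM.
    - exact: emeasurable_funD.
    - move=> t _; rewrite -!EFinM -EFinD lee_fin normrM exprMn.
      rewrite !exprM -[xi t ^+ 2]real_normK ?num_real// -[Z t ^+ 2]real_normK ?num_real//.
      rewrite -!exprM ![(2 * j)%N]mulnC !exprM.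
      set x := _ ^+ j; set z := _ ^+ j.
      rewrite -subr_ge0.
      have -> : la / 2 * x ^+ 2 + (2 * la)^-1 * z ^+ 2 - x * z =
        (2 * la)^-1 * (la * x - z) ^+ 2.
        by field; rewrite gt_eqF.
      by rewrite mulr_ge0 ?sqr_ge0// invr_ge0 mulr_ge0// ltW.
  rewrite ge0_integralD// ge0_integralZl// ge0_integralZl//.
  rewrite EFinD; apply: leeD.
    by rewrite mulrAC [((_ * a)%:E)]EFinM; exact: lee_wpmul2l.
  by rewrite [b / _]mulrC EFinM; exact: lee_wpmul2l.
(* For [H = 0] the balancing parameter used below degenerates; but then [b = 0], and [la] may be
   taken arbitrarily small. *)
move: H0; rewrite le_eqVlt => /predU1P[H0|H0].
  have b0 : b = 0 by rewrite /b -H0 expr0n muln_eq0/= gtn_eqF// mulr0.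
  rewrite -H0 mulr0 expr0n gtn_eqF// mulr0.
  apply/lee_addgt0Pr => e e0; rewrite add0e.
  apply: le_trans (key (2 * e / a) _) _; first by rewrite divr_gt0// mulr_gt0.
  by rewrite b0 mul0r addr0 lee_fin le_eqVlt; apply/orP; left; apply/eqP; field; rewrite gt_eqF.
(* This [la] makes both terms multiples of [j! (K H)^j], up to the factor [(2 e)^j]. *)
apply: le_trans (key ((H / K) ^+ j) _) _; first by rewrite exprn_gt0// divr_gt0.
rewrite lee_fin.
have e0 : 0 < expR 1 :> R by exact: expR_gt0.
have e1 : 1 <= (2 * expR 1) ^+ j :> R.
  have ee : 1 <= expR 1 :> R by apply: le_trans (expR_ge1Dx 1); rewrite lerDl.
  by apply: exprn_ege1; lra.
have bE : b <= j`!%:R * (2 * expR 1) ^+ j * H ^+ (2 * j).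
  have H0' := ltW H0.
  rewrite /b ler_wpM2r ?exprn_ge0// natrM !exprMn mulrCA.
  by rewrite ler_wpM2l ?exprn_ge0// expn_le_fact.
have -> : (H / K) ^+ j * a / 2 = j`!%:R * (K * H) ^+ j / 2.
  rewrite /a mul2n -addnn exprD expr_div_n exprMn; field.
  by rewrite expf_neq0// gt_eqF.
apply: (@le_trans _ _ (j`!%:R * (K * H) ^+ j / 2 + j`!%:R * (2 * expR 1 * (K * H)) ^+ j / 2)).
  rewrite lerD2l.
  have -> : j`!%:R * (2 * expR 1 * (K * H)) ^+ j / 2 =
    (j`!%:R * (2 * expR 1) ^+ j * H ^+ (2 * j)) / (2 * (H / K) ^+ j).
    rewrite mul2n -addnn exprD expr_div_n !exprMn; field.
    by rewrite !expf_neq0// gt_eqF.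
  by apply: ler_wpM2r => //; rewrite invr_ge0 mulr_ge0// exprn_ge0// divr_ge0// ltW.
rewrite -[2 * expR 1 * K * H]mulrA [(_ * (K * H)) ^+ j]exprMn.
have kh0 : 0 <= j`!%:R * (K * H) ^+ j by rewrite mulr_ge0// exprn_ge0// mulr_ge0// ltW.
have := ler_wpM2l kh0 e1; lra.
Qed.

(** * Tail bounds for sums of i.i.d. variables *)

(** The threshold is a multiple [x] of the moment bound [y], so the probability bound is free of [y]
    and the case [y = 0] makes sense: there [Z] vanishes almost everywhere. This case covers links
    of norm 0 and a vanishing psi_2 norm. *)
Lemma markov_pow {d : measure_display} {T : measurableType d}
    {R : realType} (P : probability T R) (Z : T -> R) (x y : R) (m : nat) :
  measurable_fun setT Z -> (forall t, 0 <= Z t) -> 0 < x -> 0 <= y -> (0 < m)%N ->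
  (\int[P]_t (Z t ^+ m)%:E <= (y ^+ m)%:E)%E ->
  measurable [set t | x * y < Z t] /\
  (P [set t | (x * y < Z t)%R] <= (x ^- m)%:E)%E.
Proof.
move=> mZ Z0 x0 y0 m0 Zy.
set B := [set t | _].
have mB : measurable B.
  have -> : B = setT `&` Z @^-1` `]x * y, +oo[%classic.
    by apply/seteqP; split => t /=; rewrite in_itv/= andbT// => -[].
  by apply: mZ => //; exact: measurable_itv.
split => //.
have mZm : measurable_fun setT (fun t => (Z t ^+ m)%:E).
  by apply/measurable_EFinP; exact: measurable_funX.
move: y0; rewrite le_eqVlt => /predU1P[y0|y0].
  suff -> : P B = 0%E by rewrite lee_fin invr_ge0 exprn_ge0// ltW.
  have I0 : (\int[P]_t `|(Z t ^+ m)%:E| = 0)%E.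
    apply/eqP; rewrite eq_le integral_ge0// andbT.
    under eq_integral => t _ do rewrite gee0_abs ?lee_fin ?exprn_ge0//.
    by apply: le_trans Zy _; rewrite -y0 expr0n gtn_eqF.
  have /negligibleP := (ae_eq_integral_abs P measurableT mZm).1 I0.
  have mC : measurable (~` [set x0 : T | [set: T] x0 -> (Z x0 ^+ m)%:E = cst 0%E x0]).
    apply: measurableC.
    have -> : [set x0 : T | [set: T] x0 -> (Z x0 ^+ m)%:E = cst 0%E x0] =
        (fun t => Z t ^+ m) @^-1` [set 0].
      by apply/seteqP; split => t /=; [move=> /(_ I) []|move=> -> _].
    by rewrite -[X in measurable X]setTI; exact: measurable_funX.
  move=> /(_ mC) C0.
  apply/eqP; rewrite eq_le measure_ge0 andbT -C0.
  apply: le_measure; rewrite ?inE//.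
  move=> t; rewrite /B/= -y0 mulr0 => Zt /(_ I) [] /eqP.
  by rewrite expf_eq0 m0/= gt_eqF.
have xy0 : 0 < (x * y) ^+ m by rewrite exprn_gt0// mulr_gt0.
have : (((x * y) ^+ m)%:E * P B <= (y ^+ m)%:E)%E.
  apply: le_trans Zy.
  rewrite -[X in P X]setIT -integral_indic// -ge0_integralZl//; last 2 first.
    by apply/measurable_EFinP; exact: measurable_indic.
    by rewrite lee_fin ltW.
  apply: ge0_le_integral => //.
  - by move=> t _; rewrite -EFinM lee_fin mulr_ge0// ltW.
  - by apply: emeasurable_funM => //; apply/measurable_EFinP; exact: measurable_indic.
  - move=> t _; rewrite -EFinM lee_fin indicE.
    have [/set_mem Bt|_] := boolP (t \in B); last by rewrite mulr0 exprn_ge0.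
    by rewrite mulr1 lerXn2r// ?nnegrE ?Z0//; apply: ltW => //; rewrite mulr_gt0.
rewrite -lee_pdivlMl// => /le_trans; apply.
rewrite -EFinM lee_fin exprMn invfM -mulrA mulVf ?mulr1//.
by rewrite expf_neq0// gt_eqF.
Qed.

Lemma leq_fact_expn n : (n`! <= n ^ n)%N.
Proof.
elim: n => // n IH; rewrite factS expnS leq_mul2l/=.
by apply: leq_trans IH _; case: n => // n; rewrite leq_exp2r.
Qed.

Lemma geometric_le2 {R : realType} (x : R) n :
  0 <= x -> x <= 2^-1 -> \sum_(j < n) x ^+ j <= 2.
Proof.
move=> x0 x2; have := subrX1 x n; have := exprn_ge0 n x0.
set S := \sum_(j < n) _ => xn E.
have S0 : 0 <= S by apply: sumr_ge0 => j _; exact: exprn_ge0.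
nra.
Qed.

Lemma cauchy_schwarz_sum {R : realType} (I : finType) (a b : I -> R) :
  (\sum_i a i * b i) ^+ 2 <= (\sum_i a i ^+ 2) * (\sum_i b i ^+ 2).
Proof.
set Sa := \sum_i a i ^+ 2; set Sb := \sum_i b i ^+ 2; set S := \sum_i a i * b i.
have Sa0 : 0 <= Sa by apply: sumr_ge0 => i _; exact: sqr_ge0.
have : 0 <= \sum_i (Sa * b i - S * a i) ^+ 2.
  by apply: sumr_ge0 => i _; exact: sqr_ge0.
have -> : \sum_i (Sa * b i - S * a i) ^+ 2 = Sa * (Sa * Sb - S ^+ 2).
  transitivity (\sum_i (Sa ^+ 2 * b i ^+ 2 - 2 * Sa * S * (a i * b i) + S ^+ 2 * a i ^+ 2)).
    by apply: eq_bigr => i _; ring.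
  by rewrite big_split/= sumrB -!mulr_sumr -/Sa -/Sb -/S; ring.
move: Sa0; rewrite le_eqVlt => /predU1P[Sa0 _|Sa0]; last by rewrite pmulr_rge0// subr_ge0.
suff -> : S = 0 by rewrite -Sa0 mul0r expr0n.
rewrite /S big1// => i _.
have /eqP := esym Sa0; rewrite psumr_eq0; last by move=> j _; exact: sqr_ge0.
by move=> /allP/(_ i (mem_index_enum _)); rewrite sqrf_eq0 => /eqP ->; rewrite mul0r.
Qed.

Section iid.
Context {d : measure_display} {T : measurableType d} {R : realType}.
Context (P : probability T R) {d' : measure_display} {U : measurableType d'}.
Context (N : nat) (Ys : 'I_N -> T -> U) (Y : T -> U).
Context (mYs : forall i, measurable_fun setT (Ys i)) (mY : measurable_fun setT Y).
Context (indY : mutually_independent P Ys) (lawY : forall i, same_law P (Ys i) Y).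

Lemma iid_moment_le (G : U -> R) (b : nat -> R) (A tau rho : R) (q k : nat) :
  measurable_fun setT G -> 0 <= A -> 0 < tau -> (forall j, 0 <= b j) ->
  (forall j, (j <= q)%N -> P.-integrable setT (fun t => (G (Y t) ^+ j)%:E)) ->
  (forall j, (j <= q)%N -> `|\int[P]_t (G (Y t) ^+ j)| <= j`!%:R * A ^+ j * b j) ->
  \sum_(j < q.+1) b j / tau ^+ j <= rho -> (k <= q)%N ->
  (\int[P]_t ((\sum_i G (Ys i t)) ^+ k)%:E <= (k`!%:R * (A * tau) ^+ k * rho ^+ N)%:E)%E.
Proof.
move=> mG A0 tau0 b0 iG aG brho kq.
pose a j := \int[P]_t (G (Y t) ^+ j).
have aE i j : (j <= q)%N -> P.-integrable setT (fun t => (G (Ys i t) ^+ j)%:E) /\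
    \int[P]_t (G (Ys i t) ^+ j) = a j.
  move=> jq.
  have mGj : measurable_fun setT (fun x => (G x ^+ j)%:E).
    by apply/measurable_EFinP; exact: measurable_funX.
  have e f mf := same_law_integral P (Ys i) Y f (mYs i) mY (lawY i) mf.
  split; last by rewrite /a /Rintegral (e (fun x => (G x ^+ j)%:E)).
  apply/integrableP; split; first exact: (measurableT_comp mGj).
  have /integrableP[_] := iG _ jq.
  rewrite (e (fun x => `|(G x ^+ j)%:E|%E))//.
  exact: measurableT_comp.
have [iS eS] := moment_sum_indep P N Ys G a q k mYs indY mG aE kq.
rewrite -[X in (X <= _)%E]fineK; last exact: integrable_fin_num.
rewrite lee_fin -[X in X <= _]/(\int[P]_t ((\sum_i G (Ys i t)) ^+ k)) eS.
apply: le_trans (ler_norm _) _.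
exact: (@sum_moment_le _ a b A tau rho q N k).
Qed.

(** No cancellation is used. With all weights 1 and [tau = 2] each summand costs a factor [rho = 2],
    and [2^N <= 4^k] because [N <= 2 k]; this is absorbed in the constant 16. *)
Lemma iid_tail_ge0 (G : U -> R) (A x : R) (k : nat) :
  measurable_fun setT G -> (forall y, 0 <= G y) -> 0 <= A ->
  (forall j, (0 < j <= k)%N -> (\int[P]_t (G (Y t) ^+ j)%:E <= (j`!%:R * A ^+ j)%:E)%E) ->
  0 < x -> (0 < k)%N -> (N <= 2 * k)%N ->
  measurable [set t | x * (16 * A * k%:R) < \sum_i G (Ys i t)] /\
  (P [set t | (x * (16 * A * k%:R) < \sum_i G (Ys i t))%R] <= (x ^- k)%:E)%E.
Proof.
move=> mG G0 A0 GA x0 k0 Nk.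
have GA' j : (j <= k)%N -> (\int[P]_t (G (Y t) ^+ j)%:E <= (j`!%:R * A ^+ j)%:E)%E.
  case: j => [_|j jk]; last exact: GA.
  under eq_integral do rewrite expr0.
  by rewrite integral_cst// [X in (_ * X)%E](probability_setT P) mule1 fact0 expr0 mulr1.
have mGj j : measurable_fun setT (fun t => (G (Y t) ^+ j)%:E).
  by apply/measurable_EFinP; apply: measurable_funX; exact: measurableT_comp.
have iG j : (j <= k)%N -> P.-integrable setT (fun t => (G (Y t) ^+ j)%:E).
  move=> jk; apply/integrableP; split => //.
  under eq_integral => t _ do rewrite gee0_abs ?lee_fin ?exprn_ge0//.
  by apply: le_lt_trans (GA' _ jk) _; rewrite ltry.
have kR : 0 < k%:R :> R by rewrite ltr0n.
apply: markov_pow => //.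
- by apply: measurable_sum => i; exact: measurableT_comp.
- by move=> t; apply: sumr_ge0.
- by rewrite !mulr_ge0.
apply: le_trans (@iid_moment_le G (fun=> 1) A 2 2 k k _ _ _ _ _ _ _ _) _ => //.
- move=> j jk; rewrite mulr1 ger0_norm; last first.
    by apply: Rintegral_ge0 => t _; rewrite exprn_ge0.
  rewrite -lee_fin fineK; first exact: GA'.
  by apply: integrable_fin_num => //; exact: iG.
- under eq_bigr do rewrite mul1r -exprVn.
  by apply: geometric_le2 => //; rewrite invr_ge0.
rewrite lee_fin.
have -> : (16 * A * k%:R) ^+ k = k%:R ^+ k * (A * 2) ^+ k * (4 ^+ k * 2 ^+ k).
  by rewrite -!exprMn; congr (_ ^+ _); ring.
apply: ler_pM => //.
- by rewrite mulr_ge0// exprn_ge0// mulr_ge0.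
- apply: ler_wpM2r; first by rewrite exprn_ge0// mulr_ge0.
  by rewrite -natrX ler_nat leq_fact_expn.
apply: (@le_trans _ _ (4 ^+ k)); last by rewrite ler_peMr ?exprn_ge0// exprn_ege1// ler1n.
have -> : 4 = 2 ^+ 2 :> R by ring.
by rewrite -exprM; apply: ler_weXn2l => //; rewrite ler1n.
Qed.

(** Centring removes the weight of order 1, so a summand costs only [rho = 1 + 2 / tau^2] and the
    power [rho^N] stays below [e^m] for a suitable [tau]. The tail is stated for the square of the
    sum, whose [m]-th moment is the even moment of order [2 m]. *)
Lemma iid_tail_centered (G : U -> R) (A x : R) (m : nat) :
  measurable_fun setT G -> 0 <= A ->
  P.-integrable setT (fun t => (G (Y t))%:E) -> \int[P]_t (G (Y t)) = 0 ->
  (forall j, (0 < j <= 2 * m)%N ->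
     (\int[P]_t (`|G (Y t)| ^+ j)%:E <= (j`!%:R * A ^+ j)%:E)%E) ->
  0 < x -> (0 < m)%N -> (2 * m <= N)%N ->
  measurable [set t | x * (8 * expR 1 * m%:R * N%:R * A ^+ 2) < (\sum_i G (Ys i t)) ^+ 2] /\
  (P [set t | (x * (8 * expR 1 * m%:R * N%:R * A ^+ 2) < (\sum_i G (Ys i t)) ^+ 2)%R]
     <= (x ^- m)%:E)%E.
Proof.
move=> mG A0 iG1 G0 GA x0 m0 mN.
have mR : 0 < m%:R :> R by rewrite ltr0n.
have N0 : 0 < N%:R :> R by rewrite ltr0n; apply: leq_trans mN; rewrite muln_gt0.
have mGj j : measurable_fun setT (fun t => (G (Y t) ^+ j)%:E).
  by apply/measurable_EFinP; apply: measurable_funX; exact: measurableT_comp.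
have iG j : (j <= 2 * m)%N -> P.-integrable setT (fun t => (G (Y t) ^+ j)%:E).
  case: j => [_|j jk].
    by under eq_fun do rewrite expr0; exact: finite_measure_integrable_cst.
  apply/integrableP; split => //.
  under eq_integral => t _ do rewrite abse_EFin normrX.
  by apply: le_lt_trans (GA j.+1 _) _; rewrite ?ltry.
pose b (j : nat) : R := if j == 1%N then 0 else 1.
have b0 j : 0 <= b j by rewrite /b; case: ifP.
(* Then [2 / tau^2 = m / N]. The assumption [2 m <= N] gives [tau >= 2], which the geometric series
   requires. *)
pose tau : R := Num.sqrt (2 * N%:R / m%:R).
have tau2E : tau ^+ 2 = 2 * N%:R / m%:R.
  by rewrite sqr_sqrtr// divr_ge0// ?mulr_ge0// ltW.
have tau2 : 2 <= tau.
  rewrite -(@ler_pXn2r _ 2)// ?nnegrE ?sqrtr_ge0// tau2E ler_pdivlMr//.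
  have : (2 * m)%:R <= N%:R :> R by rewrite ler_nat.
  rewrite natrM; lra.
have tau0 : 0 < tau by apply: lt_le_trans tau2.
apply: markov_pow => //.
- by apply: measurable_funX; apply: measurable_sum => i; exact: measurableT_comp.
- by move=> t; exact: sqr_ge0.
- by rewrite !mulr_ge0// ?sqr_ge0// ?expR_ge0// ltW.
under eq_integral do rewrite -exprM.
apply: le_trans (@iid_moment_le G b A tau (1 + m%:R / N%:R) (2 * m) (2 * m) _ _ _ _ _ _ _ _) _ => //.
- move=> j; case: j => [_|[_|j jm]].
  + under eq_Rintegral do rewrite expr0.
    rewrite Rintegral_cst// [X in fine X](probability_setT P) /b/= fact0 expr0 !mulr1.
    by rewrite normr1.
  + by rewrite [X in `|X|]G0 normr0 /b/= mulr0.
  + rewrite /b/= mulr1.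
    apply: le_trans (le_normr_Rintegral _ _) _ => //; first exact: iG.
    under eq_Rintegral do rewrite normrX.
    rewrite -lee_fin fineK; first exact: GA.
    rewrite ge0_fin_numE; last by apply: integral_ge0 => t _; rewrite lee_fin exprn_ge0.
    by apply: le_lt_trans (GA j.+2 _) _; rewrite ?ltry.
- have -> : (2 * m).+1 = (2 * m).-1.+2 by rewrite prednK// muln_gt0.
  rewrite 2!big_ord_recl/= {1 2}/b/= expr0 divr1 mul0r add0r lerD2l.
  apply: (@le_trans _ _ (tau ^- 2 * \sum_(j < (2 * m).-1) tau^-1 ^+ j)).
    rewrite mulr_sumr; apply: ler_sum => j _.
    by rewrite /b/= mul1r /bump/= !add1n -exprVn -exprVn -exprD.
  apply: (@le_trans _ _ (tau ^- 2 * 2)).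
    apply: ler_wpM2l; first by rewrite invr_ge0 exprn_ge0// ltW.
    apply: geometric_le2; first by rewrite invr_ge0 ltW.
    by rewrite lef_pV2// posrE.
  rewrite tau2E le_eqVlt; apply/orP; left; apply/eqP; field.
  by rewrite !gt_eqF.
rewrite lee_fin.
have e1 : (1 + m%:R / N%:R) ^+ N <= expR 1 ^+ m :> R.
  apply: (@le_trans _ _ (expR (m%:R / N%:R) ^+ N)).
    by rewrite lerXn2r// ?nnegrE ?expR_ge0 ?expR_ge1Dx// addr_ge0// divr_ge0.
  rewrite -expRM_natl -expRM_natl mulr1 mulrC divfK//.
  by rewrite gt_eqF.
apply: (@le_trans _ _ ((2 * m)%:R ^+ (2 * m) * (A * tau) ^+ (2 * m) * expR 1 ^+ m)).
  apply: ler_pM => //.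
  - by rewrite mulr_ge0// exprn_ge0// mulr_ge0// ltW.
  - apply: ler_wpM2r; first by rewrite exprn_ge0// mulr_ge0// ltW.
    by rewrite -natrX ler_nat leq_fact_expn.
rewrite exprM [(A * tau) ^+ (2 * m)]exprM -!exprMn.
rewrite le_eqVlt; apply/orP; left; apply/eqP; congr (_ ^+ m).
rewrite natrM !exprMn tau2E; field.
by rewrite gt_eqF.
Qed.

End iid.

(** * One link of the chain *)

Lemma exprD_le {R : realType} (x y : R) j : 0 <= x -> 0 <= y ->
  (x + y) ^+ j <= 2 ^+ j * (x ^+ j + y ^+ j).
Proof.
move=> x0 y0; wlog xy : x y x0 y0 / x <= y.
  move=> H; have [/H|/ltW/H] := leP x y; first exact.
  by rewrite [y + x]addrC [y ^+ j + _]addrC; apply.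
apply: (@le_trans _ _ ((2 * y) ^+ j)).
  by rewrite lerXn2r// ?nnegrE; lra.
by rewrite exprMn ler_wpM2l ?exprn_ge0// lerDr exprn_ge0.
Qed.

Lemma expR1_ge1 {R : realType} : 1 <= expR 1 :> R.
Proof. by apply: le_trans (expR_ge1Dx 1); rewrite lerDl. Qed.

Lemma expR1Xn {R : realType} (n : nat) : expR 1 ^+ n = expR n%:R :> R.
Proof. by rewrite -expRM_natl mulr1. Qed.

Section multiplier.
Context {d : measure_display} {T : measurableType d} {R : realType}.
Context (P : probability T R) {dO : measure_display} {Omega : measurableType dO}.
Context (X : T -> Omega) (xi : T -> R) (N : nat).
Context (Xs : 'I_N -> T -> Omega) (xis : 'I_N -> T -> R) (K : R).
Context (mX : measurable_fun setT X) (mxi : measurable_fun setT xi).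
Context (mXs : forall i, measurable_fun setT (Xs i)).
Context (mxis : forall i, measurable_fun setT (xis i)).
Context (indY : mutually_independent P (fun i t => (Xs i t, xis i t))).
Context (lawY : forall i,
  same_law P (fun t => (Xs i t, xis i t)) (fun t => (X t, xi t))).
Context (K0 : 0 < K) (N0 : (0 < N)%N).
Context (xiK : (\int[P]_t (expR ((`|xi t| / K) ^+ 2))%:E <= 2%:E)%E).

Let U := (Omega * R)%type.
Local Notation e := (expR (1 : R)).

Let mY : measurable_fun setT (fun t => (X t, xi t)).
Proof. exact: measurable_fun_pair. Qed.

Let mYs i : measurable_fun setT (fun t => (Xs i t, xis i t)).
Proof. exact: measurable_fun_pair. Qed.

Let e1 : 1 <= e. Proof. exact: expR1_ge1. Qed.
Let e0 : 0 < e. Proof. exact: expR_gt0. Qed.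

Lemma multiplier_sq_tail (w : R) : 1 <= w ->
  exists B, [/\ measurable B, (P B <= (expR (- (N%:R * w ^+ 2)))%:E)%E &
    forall t, ~ B t -> \sum_i xis i t ^+ 2 <= 32 * e * N%:R * w ^+ 2 * K ^+ 2].
Proof.
move=> w1.
have w2 : 1 <= w ^+ 2 by rewrite exprn_ege1.
have NR : 1 <= N%:R :> R by rewrite ler1n.
pose v := N%:R * w ^+ 2.
have v1 : 1 <= v by rewrite /v; nra.
(* The order of the moment is the first integer above [v = N w^2]: Markov's inequality with [x = e]
   gives [exp (- k) <= exp (- v)], while [k <= 2 v] keeps the threshold of order [v]. *)
pose k := (Num.truncn v).+1.
have vk : v <= k%:R by apply: ltW; exact: truncnS_gt.
have kv : k%:R <= 2 * v.
  have : (Num.truncn v)%:R <= v by rewrite truncn_le; lra.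
  rewrite /k -[(Num.truncn v).+1%:R]natr1; lra.
have k0 : (0 < k)%N by [].
have mG : measurable_fun setT (fun u : U => u.2 ^+ 2).
  by apply: measurable_funX; exact: measurable_snd.
have [||j /andP[j0 _]||||mB PB] := iid_tail_ge0 P N _ _ mYs mY indY lawY
    (fun u : U => u.2 ^+ 2) (K ^+ 2) e k mG.
- by move=> u; exact: sqr_ge0.
- exact: sqr_ge0.
- under eq_integral => t _ do rewrite -exprM.
  by rewrite -exprM; exact: psi2_moment.
- exact: e0.
- exact: k0.
- rewrite -(ler_nat R) natrM; apply: le_trans (_ : v <= _).
    by rewrite /v ler_peMr.
  lra.
set B := [set t | _] in mB PB; exists B; split => //.
  apply: le_trans PB _; rewrite lee_fin expR1Xn -expRN ler_expR lerN2 //.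
move=> t /= /negP; rewrite -leNgt => /le_trans; apply.
have -> : 32 * e * N%:R * w ^+ 2 * K ^+ 2 = e * (16 * K ^+ 2 * (2 * v)) by rewrite /v; ring.
by rewrite ler_pM2l// ler_wpM2l// mulr_ge0// sqr_ge0.
Qed.

Section link.
Context (h : Omega -> R) (p H : R).
Context (mh : measurable_fun setT h) (p64 : 64 <= p) (H0 : 0 <= H).
Context (hH : (fnorm P X p h <= H%:E)%E).

Let mhX : measurable_fun setT (h \o X).
Proof. exact: measurableT_comp. Qed.

Lemma multiplier_moment j : (0 < j)%N -> (2 * j)%:R <= p ->
  (\int[P]_t (`|xi t * h (X t)| ^+ j)%:E <= (j`!%:R * (2 * e * K * H) ^+ j)%:E)%E.
Proof.
move=> j0 jp; apply: integral_normM_le => //.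
  exact: psi2_moment.
exact: (pnorm_moment P p).
Qed.

Lemma multiplier_integrable : P.-integrable setT (fun t => (xi t * h (X t))%:E).
Proof.
apply/integrableP; split.
  by apply/measurable_EFinP; exact: measurable_funM.
have := @multiplier_moment 1 isT; under eq_integral do rewrite expr1.
move=> /(_ _)/le_lt_trans; apply; last by rewrite ltry.
by rewrite muln1; apply: le_trans p64; rewrite ler_nat.
Qed.

Let mu := \int[P]_t (xi t * h (X t)).

Lemma multiplier_mean_le : `|mu| <= 2 * e * K * H.
Proof.
apply: le_trans (le_normr_Rintegral _ multiplier_integrable) _ => //.
rewrite -lee_fin fineK.
  have := @multiplier_moment 1 isT; rewrite (_ : 1`!%N = 1%N)// mul1r expr1; apply.
  by rewrite muln1; apply: le_trans p64; rewrite ler_nat.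
have /integrableP[_] := multiplier_integrable.
by rewrite ge0_fin_numE//; apply: integral_ge0 => t _; rewrite lee_fin.
Qed.

Let A0 := 2 * e * K * H.
Let A00 : 0 <= A0. Proof. by rewrite !mulr_ge0// ltW. Qed.

Lemma multiplier_centered_moment j : (0 < j)%N -> (2 * j)%:R <= p ->
  (\int[P]_t (`|xi t * h (X t) - mu| ^+ j)%:E <= (j`!%:R * (8 * e * K * H) ^+ j)%:E)%E.
Proof.
move=> j0 jp.
have m1 : measurable_fun setT (fun t => (`|xi t * h (X t)| ^+ j)%:E).
  apply/measurable_EFinP; apply: measurable_funX; apply: measurableT_comp => //.
  exact: measurable_funM.
have c0 : (0 <= (2 ^+ j : R)%:E)%E by rewrite lee_fin exprn_ge0.
apply: (@le_trans _ _ (\int[P]_t ((2 ^+ j)%:E * ((`|xi t * h (X t)| ^+ j)%:E + (A0 ^+ j)%:E))%E)%E).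
  apply: ge0_le_integral => //.
  - apply/measurable_EFinP; apply: measurable_funX; apply: measurableT_comp => //.
    by apply: measurable_funB => //; exact: measurable_funM.
  - by apply: emeasurable_funM => //; exact: emeasurable_funD.
  - move=> t _; rewrite -EFinD -EFinM lee_fin.
    apply: (@le_trans _ _ ((`|xi t * h (X t)| + A0) ^+ j)).
      rewrite lerXn2r ?nnegrE ?addr_ge0//.
      by apply: le_trans (ler_normB _ _) _; rewrite lerD2l multiplier_mean_le.
    exact: exprD_le.
rewrite ge0_integralZl//; last 2 first.
  exact: emeasurable_funD.
  by move=> t _; rewrite -EFinD lee_fin addr_ge0// exprn_ge0.
rewrite ge0_integralD//; last by move=> t _; rewrite lee_fin exprn_ge0.
rewrite integral_cst// [X in (_ + _ * X)%E](probability_setT P) mule1.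
apply: (@le_trans _ _ ((2 ^+ j)%:E * ((j`!%:R * A0 ^+ j)%:E + (A0 ^+ j)%:E))%E).
  by apply: lee_wpmul2l => //; apply: leeD2r; exact: multiplier_moment.
rewrite -EFinD -EFinM lee_fin.
(* One factor 2 comes from [(x + y)^j <= 2^j (x^j + y^j)], the other from
   [j! + 1 <= 2 j! <= 2^j j!]. *)
have -> : 8 * e * K * H = 4 * A0 by rewrite /A0; ring.
have f1 : 1 <= j`!%:R :> R by rewrite ler1n fact_gt0.
have -> : (4 * A0) ^+ j = 2 ^+ j * (2 ^+ j * A0 ^+ j).
  by rewrite -!exprMn; congr (_ ^+ _); ring.
rewrite mulrCA ler_wpM2l ?exprn_ge0//.
have a0 : 0 <= A0 ^+ j by rewrite exprn_ge0.
have t2 : 2 <= 2 ^+ j :> R by rewrite -[X in X <= _]expr1 ler_weXn2l// ler1n.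
apply: (@le_trans _ _ (j`!%:R * (2 * A0 ^+ j))); first nra.
by apply: ler_wpM2l => //; apply: ler_wpM2r.
Qed.

Lemma multiplier_link_tail (w : R) : 1 <= w ->
  exists B, [/\ measurable B, (P B <= (expR (- p))%:E)%E &
    forall t, ~ B t -> \sum_i xis i t ^+ 2 <= 32 * e * N%:R * w ^+ 2 * K ^+ 2 ->
      `|\sum_i xis i t * h (Xs i t) - N%:R * mu| <=
      23 * e ^+ 6 * w * Num.sqrt N%:R * Num.sqrt p * K * H].
Proof.
move=> w1.
have p64' := p64; have e1' := e1.
have p0 : 0 < p by lra.
have NR : 0 < N%:R :> R by rewrite ltr0n.
(* [4 m <= p] makes the moments of the products available up to order [2 m]. Conversely [p <= 8 m],
   so Markov's inequality with [x = e^8] gives [exp (- p)]; the rounding is harmless since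
   [p >= 64]. *)
pose m := Num.truncn (p / 4).
have mp : 4 * m%:R <= p.
  have : m%:R <= p / 4 by rewrite truncn_le divr_ge0// ltW.
  lra.
have pm : p <= 8 * m%:R.
  have : p / 4 < m.+1%:R by exact: truncnS_gt.
  rewrite -[m.+1%:R]natr1; lra.
have mR : 0 < m%:R :> R by lra.
have m0 : (0 < m)%N by rewrite -(ltr0n R).
have xm : (((e ^+ 8) ^- m)%:E <= (expR (- p))%:E)%E.
  rewrite lee_fin -exprM expR1Xn -expRN ler_expR lerN2 natrM; lra.
have x0 : 0 < e ^+ 8 by rewrite exprn_gt0.
(* Both regimes bound a square. Here [529 = 23^2], chosen above the value [2 * 256 + 2 * 2] that the
   second regime produces. *)
have sq (W : R) : W ^+ 2 <= 529 * e ^+ 12 * w ^+ 2 * N%:R * p * (K * H) ^+ 2 ->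
    `|W| <= 23 * e ^+ 6 * w * Num.sqrt N%:R * Num.sqrt p * K * H.
  move=> WH; rewrite -(@ler_pXn2r _ 2)// ?nnegrE//; last first.
    by rewrite !mulr_ge0// ?sqrtr_ge0// ?exprn_ge0// ?ltW//; lra.
  rewrite real_normK ?num_real//; apply: le_trans WH _.
  rewrite le_eqVlt; apply/orP; left; apply/eqP.
  transitivity (529 * e ^+ 12 * w ^+ 2 * (Num.sqrt N%:R) ^+ 2 * (Num.sqrt p) ^+ 2 * (K * H) ^+ 2); last by ring.
  by rewrite !sqr_sqrtr// ltW.
have eX n : 0 <= e ^+ n by rewrite exprn_ge0// ltW.
have aux (s2 m2 d2 a a' M0 : R) : s2 <= a -> m2 <= a' -> a <= 256 * M0 ->
    a' <= 2 * M0 -> 0 <= d2 -> 0 <= M0 -> 2 * s2 + 2 * m2 - d2 <= 529 * M0.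
  by lra.
have w2 : 1 <= w ^+ 2 by rewrite exprn_ege1.
pose Q := (K * H) ^+ 2.
have Q0 : 0 <= Q by exact: sqr_ge0.
have NpQ : 0 <= N%:R * p * Q by rewrite !mulr_ge0// ltW.
have [mN|Nm] := leqP (2 * m) N.
  have mG : measurable_fun setT (fun u : U => u.2 * h u.1 - mu).
    apply: measurable_funB => //; apply: measurable_funM; first exact: measurable_snd.
    by apply: measurableT_comp => //; exact: measurable_fst.
  have iG : P.-integrable setT (fun t => (xi t * h (X t) - mu)%:E).
    under eq_fun do rewrite EFinB.
    apply: integrableB => //; first exact: multiplier_integrable.
    exact: finite_measure_integrable_cst.
  have G0 : \int[P]_t (xi t * h (X t) - mu) = 0.
    rewrite RintegralB//; last 2 first.
    - exact: multiplier_integrable.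
    - exact: finite_measure_integrable_cst.
    by rewrite Rintegral_cst// [X in fine X](probability_setT P) mulr1 subrr.
  have [|j /andP[j0 jm]|mB PB] := iid_tail_centered P N _ _ mYs mY indY lawY
    (fun u : U => u.2 * h u.1 - mu) (8 * e * K * H) (e ^+ 8) m mG _ iG G0 _ x0 m0 mN.
  - by rewrite !mulr_ge0// ltW.
  - apply: multiplier_centered_moment => //.
    apply: le_trans mp; rewrite natrM.
    by have : j%:R <= (2 * m)%:R :> R; [rewrite ler_nat|rewrite natrM; lra].
  set B := [set t | _] in mB PB; exists B; split => //; first exact: le_trans PB _.
  move=> t /= /negP; rewrite -leNgt => WB _.
  apply: sq; move: WB; rewrite /= sumrB sumr_const card_ord -[mu *+ N]mulr_natl => /le_trans; apply.
  have -> : e ^+ 8 * (8 * e * m%:R * N%:R * (8 * e * K * H) ^+ 2) =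
    128 * e ^+ 11 * ((4 * m%:R) * (N%:R * Q)) by rewrite /Q; ring.
  have -> : 529 * e ^+ 12 * w ^+ 2 * N%:R * p * (K * H) ^+ 2 =
     (529 * e * w ^+ 2) * e ^+ 11 * (p * (N%:R * Q)) by rewrite /Q; ring.
  have NQ : 0 <= N%:R * Q by rewrite mulr_ge0// ltW.
  apply: ler_pM; [by rewrite mulr_ge0|by rewrite mulr_ge0// mulr_ge0// ltW| |].
    apply: ler_wpM2r; first exact: eX.
    rewrite -mulrA; apply: (@le_trans _ _ 529); first by rewrite ler_nat.
    by apply: ler_peMr; [exact: ler0n|exact: mulr_ege1].
  exact: ler_wpM2r.
(* Second regime: [h^2] has moments at most [j! (2 e H^2)^j], and [N < 2 m] is what the tail bound
   for nonnegative summands asks for. *)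
have mG : measurable_fun setT (fun u : U => h u.1 ^+ 2).
  apply: measurable_funX; apply: measurableT_comp => //; exact: measurable_fst.
have [||j /andP[j0 jm]|mB PB] := iid_tail_ge0 P N _ _ mYs mY indY lawY
    (fun u : U => h u.1 ^+ 2) (2 * e * H ^+ 2) (e ^+ 8) m mG _ _ _ x0 m0 (ltnW Nm).
- by move=> u; exact: sqr_ge0.
- by rewrite !mulr_ge0// ?sqr_ge0// ltW.
- under eq_integral => t _ do rewrite -exprM.
  apply: le_trans (pnorm_moment P p (h \o X) H j H0 mhX hH j0 _) _.
    apply: le_trans mp; rewrite natrM.
    have : j%:R <= m%:R :> R by rewrite ler_nat.
    have : 0 <= m%:R :> R by [].
    lra.
  rewrite lee_fin.
  have -> : j`!%:R * (2 * e * H ^+ 2) ^+ j = 2 ^+ j * (j`!%:R * e ^+ j) * H ^+ (2 * j).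
    by rewrite exprMn exprMn exprM; ring.
  have -> : (2 * j)%:R ^+ j = 2 ^+ j * j%:R ^+ j :> R by rewrite natrM exprMn.
  by rewrite ler_wpM2r ?exprn_ge0// ler_wpM2l ?exprn_ge0// expn_le_fact.
set B := [set t | _] in mB PB; exists B; split => //; first exact: le_trans PB _.
move=> t /= /negP; rewrite -leNgt => hB xB.
apply: sq.
set S := \sum_i xis i t * h (Xs i t).
have S2 : S ^+ 2 <= 256 * e ^+ 10 * w ^+ 2 * (N%:R * p * Q).
  apply: le_trans (cauchy_schwarz_sum _ (xis ^~ t) (fun i => h (Xs i t))) _.
  apply: (@le_trans _ _ ((32 * e * N%:R * w ^+ 2 * K ^+ 2) *
    (e ^+ 8 * (16 * (2 * e * H ^+ 2) * m%:R)))).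
    by apply: ler_pM => //; apply: sumr_ge0 => i _; exact: sqr_ge0.
  have -> : (32 * e * N%:R * w ^+ 2 * K ^+ 2) * (e ^+ 8 * (16 * (2 * e * H ^+ 2) * m%:R)) =
    256 * e ^+ 10 * w ^+ 2 * (N%:R * (4 * m%:R) * Q) by rewrite /Q; ring.
  apply: ler_wpM2l; first last.
    by apply: ler_wpM2r => //; apply: ler_wpM2l => //; exact: ltW.
  by apply: mulr_ge0; [apply: mulr_ge0; [exact: ler0n|exact: eX]|exact: sqr_ge0].
(* Cauchy-Schwarz was applied to the sum before centring, so the mean is estimated apart; it is
   small enough because [2 N <= 4 m <= p]. *)
have mu2 : (N%:R * mu) ^+ 2 <= 2 * e ^+ 2 * (N%:R * p * Q).
  rewrite exprMn.
  apply: (@le_trans _ _ (N%:R ^+ 2 * (2 * e * K * H) ^+ 2)).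
    apply: ler_wpM2l; first exact: sqr_ge0.
    rewrite -[mu ^+ 2]real_normK ?num_real// lerXn2r// ?nnegrE//.
    exact: multiplier_mean_le.
  have -> : N%:R ^+ 2 * (2 * e * K * H) ^+ 2 = 2 * e ^+ 2 * (N%:R * (2 * N%:R) * Q).
    by rewrite /Q; ring.
  apply: ler_wpM2l; first by rewrite mulr_ge0// sqr_ge0.
  rewrite ler_wpM2r// ler_wpM2l//.
  have : N%:R <= (2 * m)%:R :> R by rewrite ler_nat ltnW.
  rewrite natrM; lra.
have E12 : e ^+ 10 <= e ^+ 12 by rewrite ler_weXn2l.
have E2 : e ^+ 2 <= e ^+ 12 by rewrite ler_weXn2l.
have E12' : 0 <= e ^+ 12 by rewrite exprn_ge0// ltW.
have wM : 0 <= w ^+ 2 * (N%:R * p * Q) by rewrite mulr_ge0// sqr_ge0.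
have a1 : 256 * e ^+ 10 * w ^+ 2 * (N%:R * p * Q) <= 256 * (e ^+ 12 * (w ^+ 2 * (N%:R * p * Q))).
  have -> : 256 * e ^+ 10 * w ^+ 2 * (N%:R * p * Q) = 256 * (e ^+ 10 * (w ^+ 2 * (N%:R * p * Q))).
    by ring.
  by apply: ler_wpM2l; [exact: ler0n|exact: ler_wpM2r].
have a2 : 2 * e ^+ 2 * (N%:R * p * Q) <= 2 * (e ^+ 12 * (w ^+ 2 * (N%:R * p * Q))).
  rewrite -(mulrA 2); apply: ler_wpM2l; first exact: ler0n.
  by apply: ler_pM; [exact: eX|exact: NpQ|exact: E2|rewrite ler_peMl].
have -> : 529 * e ^+ 12 * w ^+ 2 * N%:R * p * (K * H) ^+ 2 =
  529 * (e ^+ 12 * (w ^+ 2 * (N%:R * p * Q))) by rewrite /Q; ring.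
have : 0 <= e ^+ 12 * (w ^+ 2 * (N%:R * p * Q)) by rewrite mulr_ge0.
have := sqr_ge0 (S + N%:R * mu).
have -> : (S - N%:R * mu) ^+ 2 = 2 * S ^+ 2 + 2 * (N%:R * mu) ^+ 2 - (S + N%:R * mu) ^+ 2 by ring.
exact: (aux _ _ _ _ _ _ S2 mu2 a1 a2).
Qed.

End link.

(** For an infinite norm the bound is vacuous and the bad event empty. The extended-real form thus
    holds for every measurable [h], as the chaining argument expects. *)
Lemma multiplier_link (h : Omega -> R) (p w : R) :
  measurable_fun setT h -> 64 <= p -> 1 <= w ->
  exists B, [/\ measurable B, (P B <= (expR (- p))%:E)%E &
    forall t, ~ B t -> \sum_i xis i t ^+ 2 <= 32 * e * N%:R * w ^+ 2 * K ^+ 2 ->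
      (`|\sum_i xis i t * h (Xs i t) - N%:R * \int[P]_x (xi x * h (X x))|%:E <=
      (23 * e ^+ 6 * w * Num.sqrt N%:R * Num.sqrt p * K)%:E * fnorm P X p h)%E].
Proof.
move=> mh p64 w1.
have c0 : 0 < 23 * e ^+ 6 * w * Num.sqrt N%:R * Num.sqrt p * K.
  by rewrite !mulr_gt0// ?sqrtr_gt0 ?ltr0n ?exprn_gt0//; lra.
have n0 : (0 <= fnorm P X p h)%E by apply: pnorm_ge0; lra.
have [fin|] := boolP (fnorm P X p h \is a fin_num).
  have [|B [mB PB HB]] := @multiplier_link_tail h p (fine (fnorm P X p h)) mh p64
    (fine_ge0 n0) _ w w1; first by rewrite fineK.
  exists B; split => // t Bt xt; rewrite -(fineK fin) -EFinM lee_fin.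
  exact: HB.
rewrite ge0_fin_numE// -leNgt leye_eq => /eqP ->.
exists set0; split => //; first by rewrite measure0 lee_fin expR_ge0.
by move=> t _ _; rewrite gt0_muley ?lte_fin// leey.
Qed.

End multiplier.

(** * Chaining *)

Lemma bigcup_ord_le {d : measure_display} {T : measurableType d} {R : realType}
    (P : probability T R) (A : nat -> set T) (n : nat) (c : R) :
  (forall i, measurable (A i)) -> (forall i, (P (A i) <= c%:E)%E) ->
  measurable (\bigcup_(i in `I_n) A i) /\
  (P (\bigcup_(i in `I_n) A i) <= (n%:R * c)%:E)%E.
Proof.
move=> mA PA; rewrite bigcup_mkord; split; first exact: bigsetU_measurable.
apply: le_trans (Boole_inequality P (fun i _ => mA i)) _.
apply: (@le_trans _ _ (\sum_(i < n) c%:E)%E); first by apply: lee_sum => i _; exact: PA.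
by rewrite sumEFin sumr_const card_ord mulr_natl.
Qed.

Lemma bigcup_geometric_le {d : measure_display} {T : measurableType d} {R : realType}
    (P : probability T R) (A : nat -> set T) (c : R) : 0 <= c ->
  (forall k, measurable (A k)) -> (forall k, (P (A k) <= (c / 2 ^+ k)%:E)%E) ->
  measurable (\bigcup_k A k) /\ (P (\bigcup_k A k) <= (2 * c)%:E)%E.
Proof.
move=> c0 mA PA; have mU : measurable (\bigcup_k A k) by exact: bigcupT_measurable.
split => //.
apply: le_trans (generalized_Boole_inequality P mA mU) _.
apply: lime_le; first by apply: is_cvg_nneseries.
near=> n.
apply: (@le_trans _ _ (\sum_(0 <= k < n) (c / 2 ^+ k)%:E)%E); first by apply: lee_sum => i _; exact: PA.
rewrite sumEFin lee_fin big_mkord -mulr_sumr mulrC; apply: ler_wpM2r => //.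
under eq_bigr do rewrite -exprVn.
by apply: geometric_le2 => //; rewrite invr_ge0.
Unshelve. all: by end_near.
Qed.

Lemma expR_le_geometric {R : realType} (a v : R) (k : nat) :
  v + k%:R <= a -> expR (- a) <= expR (- v) / 2 ^+ k.
Proof.
move=> va; apply: (@le_trans _ _ (expR (- v) * expR (- k%:R))).
  by rewrite -expRD ler_expR; lra.
apply: ler_wpM2l; first exact: expR_ge0.
rewrite expRN lef_pV2 ?posrE ?expR_gt0 ?exprn_gt0// -expR1Xn.
by rewrite lerXn2r// ?nnegrE ?expR_ge0//; have := expR_ge1Dx (1 : R); lra.
Qed.

Lemma pow2_le_expR {R : realType} (n : nat) : (2 ^ n)%:R <= expR n%:R :> R.
Proof.
rewrite natrX -expR1Xn lerXn2r// ?nnegrE ?expR_ge0//.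
by have := expR_ge1Dx (1 : R); lra.
Qed.

Lemma sub_range_ord_nat {S : Type} (n : nat) (A : set S) (s0 : S) :
  (exists g : 'I_n -> S, A `<=` range g) ->
  exists G : nat -> S, forall f, A f -> exists2 i, (i < n)%N & G i = f.
Proof.
move=> [g Ag]; exists (fun i => oapp g s0 (insub i)) => f /Ag[i _ gif].
by exists i => //; rewrite insubT//= => ltin; rewrite -gif; congr (g _); exact/val_inj.
Qed.

(** Inclusion in the range, with a default value [s0], also allows the empty set. *)
Lemma countable_sub_range {S : Type} (A : set S) (s0 : S) :
  countable A -> exists E : nat -> S, A `<=` range E.
Proof.
move=> /countable_injP[idx injidx].
have /choice[E HE] n : exists g, forall f, A f -> idx f = n -> f = g.
  have [[g [Ag gn]]|H] := pselect (exists g, A g /\ idx g = n).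
    by exists g => f Af fn; apply: injidx; rewrite ?inE// fn gn.
  by exists s0 => f Af fn; exfalso; apply: H; exists f.
by exists E => f Af; exists (idx f) => //; apply/esym/HE.
Qed.

Section chaining.
Context {d : measure_display} {T : measurableType d} {R : realType}.
Context (P : probability T R) {dO : measure_display} {Omega : measurableType dO}.
Context (X : T -> Omega) (u : R) (s0 : nat) (F : set (Omega -> R)).
Context (Fs : nat -> set (Omega -> R)) (pi : nat -> (Omega -> R) -> (Omega -> R)).
Context (mX : measurable_fun setT X) (u8 : 8 <= u).
Context (mF : forall f, F f -> measurable_fun setT f).
Context (adm : admissible_with_proj P X u F Fs pi).

Let p s : R := u ^+ 2 * 2 ^+ s.

Definition chain_sum (f : Omega -> R) : \bar R :=
  (\sum_(s0 <= s <oo)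
     ((Num.sqrt (2 ^+ s : R))%:E * fnorm P X (u ^+ 2 * 2 ^+ s) (f \- pi s f)%R)
   + (Num.sqrt (2 ^+ s0 : R))%:E * fnorm P X (u ^+ 2 * 2 ^+ s0) (pi s0 f))%E.

(** [dom] is a set on which [W] is additive. For the multiplier process it consists of the [h] with
    [xi h(X)] integrable, since the integral need not be additive elsewhere. [good] will be the
    event that bounds the sum of the [xi_i^2]. *)
Context (W : (Omega -> R) -> T -> R) (dom : set (Omega -> R)) (good : set T) (tau : R).
Context (tau0 : 0 <= tau).
Context (domD : forall a b, dom a -> dom b -> dom (a \+ b)).
Context (domB : forall a b, dom a -> dom b -> dom (a \- b)).
Context (WB : forall a b t, dom a -> dom b -> W (a \- b) t = W a t - W b t).
Context (dom_fnorm : forall s h, measurable_fun setT h ->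
  (fnorm P X (u ^+ 2 * 2 ^+ s) h < +oo)%E -> dom h).
Context (link : forall s h, measurable_fun setT h ->
  exists B, [/\ measurable B, (P B <= (expR (- (u ^+ 2 * 2 ^+ s)))%:E)%E &
    forall t, ~ B t -> good t ->
      (`|W h t|%:E <= (tau * Num.sqrt (2 ^+ s))%:E * fnorm P X (u ^+ 2 * 2 ^+ s) h)%E]).

Let p64 s : 64 <= p s.
Proof.
have u8' := u8; have : 1 <= 2 ^+ s :> R by apply: exprn_ege1; rewrite ler1n.
by rewrite /p; nra.
Qed.

Let fnorm_ge0 s h : (0 <= fnorm P X (p s) h)%E.
Proof. by apply: pnorm_ge0; apply: le_trans (p64 s); rewrite ler1n. Qed.

Let mpi s f : F f -> measurable_fun setT (pi s f).
Proof. by case: adm => [FsF [_ [_ H]]] Ff; apply/mF/(FsF s); case: (H s f Ff). Qed.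

(** A link is measured at its lower level [s], whose exponent pays for the union bound. The norm
    grows with its index, so the distance to the finer net can be read at level [s.+1], as it occurs
    in [chain_sum]. *)
Lemma fnorm_linkB s f : F f ->
  (fnorm P X (p s) (pi s.+1 f \- pi s f)%R <=
   fnorm P X (p s.+1) (f \- pi s.+1 f)%R + fnorm P X (p s) (f \- pi s f)%R)%E.
Proof.
move=> Ff.
have mc (h : Omega -> R) : measurable_fun setT h -> measurable_fun setT (h \o X) by move=> mh; exact: measurableT_comp.
have -> : fnorm P X (p s) (pi s.+1 f \- pi s f)%R =
    pnorm P (p s) (((f \- pi s f)%R \o X) \- ((f \- pi s.+1 f)%R \o X))%R.
  by congr pnorm; apply/funext => t /=; ring.
rewrite addeC; apply: le_trans (pnormB _ _ _ _ _ _) _.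
- by apply: mc; apply: measurable_funB; [exact: mF|exact: mpi].
- by apply: mc; apply: measurable_funB; [exact: mF|exact: mpi].
apply: leeD => //; apply: le_pnorm.
rewrite /p ler_wpM2l ?sqr_ge0// ler_weXn2l// ler1n//.
Qed.

(* Off the bad events of the links, [W f] is compared with [W (pi s f)] at a level
   [s] that may depend on [f]; since [F'] is countable these last links can be
   chosen so that the probabilities of their bad events are summable. *)
Lemma chaining (F' : set (Omega -> R)) :
  F' `<=` F -> countable F' -> (forall f, F f -> (chain_sum f < +oo)%E) ->
  exists B, [/\ measurable B,
    (P B <= (4 * expR (- (u ^+ 2 * 2 ^+ s0 / 4)))%:E)%E &
    forall t, ~ B t -> good t -> forall f, F' f ->
      dom f /\ (`|W f t|%:E <= (2 * tau)%:E * chain_sum f)%E].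
Proof.
move=> F'F cF' chainoo.
have /choice[Bad hBad] (sh : nat * (Omega -> R)) : exists B,
    [/\ measurable B, (P B <= (expR (- p sh.1))%:E)%E &
    measurable_fun setT sh.2 -> forall t, ~ B t -> good t ->
      (`|W sh.2 t|%:E <= (tau * Num.sqrt (2 ^+ sh.1))%:E * fnorm P X (p sh.1) sh.2)%E].
  have [mh|nmh] := pselect (measurable_fun setT sh.2).
    by have [B [mB PB HB]] := link sh.1 _ mh; exists B; split.
  by exists set0; split => //; rewrite measure0 lee_fin expR_ge0.
have mBad s h : measurable (Bad (s, h)) by case: (hBad (s, h)).
have PBad s h : (P (Bad (s, h)) <= (expR (- p s))%:E)%E by case: (hBad (s, h)).
have [FsF [_ [Fscard piP]]] := adm.
have /choice[G hG] s : exists G : nat -> Omega -> R, forall f, Fs s f ->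
    exists2 i, (i < 2 ^ (2 ^ s))%N & G i = f.
  by apply: sub_range_ord_nat; [exact: (fun=> 0)|exact: Fscard].
have [E hE] := @countable_sub_range _ _ (fun=> 0) cF'.
(* [Ev 0] concerns the starting points; each later event runs over all pairs of points from two
   consecutive nets, so that it does not depend on [f]. *)
pose Ev k := if k is k'.+1 then
    \bigcup_(i in `I_(2 ^ (2 ^ (s0 + k').+1))) \bigcup_(j in `I_(2 ^ (2 ^ (s0 + k'))))
      Bad ((s0 + k')%N, G (s0 + k').+1 i \- G (s0 + k')%N j)
  else \bigcup_(i in `I_(2 ^ (2 ^ s0))) Bad (s0, G s0 i).
(* The [n]-th function of the enumeration leaves the nets at level [s0 + n], where its last link
   fails with probability at most [exp (- Z 2^n)]. *)
pose Tl n := Bad ((s0 + n)%N, E n \- pi (s0 + n)%N (E n)).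
pose Z := u ^+ 2 * 2 ^+ s0.
(* At level [s] there are at most [exp (3 2^s)] pairs, and [3 2^s <= 3 p s / 64]. What remains of
   the exponent [p s] still exceeds [Z / 4] by the index of the event, which makes the probabilities
   summable. *)
pose v := Z / 4.
have u64 : 64 <= u ^+ 2 by have u8' := u8; nra.
have Z64 : 64 <= Z by exact: p64.
have pE k : p (s0 + k)%N = Z * 2 ^+ k by rewrite /p /Z exprD mulrA.
have pow2k k : k%:R + 1 <= 2 ^+ k :> R by rewrite natr1 -natrX ler_nat ltn_expl.
have mEv k : measurable (Ev k) /\ (P (Ev k) <= (expR (- v) / 2 ^+ k)%:E)%E.
  case: k => [|k].
    have [mE PE] := bigcup_ord_le P (fun i => Bad (s0, G s0 i)) (2 ^ (2 ^ s0)) _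
      (fun i => mBad s0 _) (fun i => PBad s0 _).
    split; first exact: mE.
    apply: le_trans PE _; rewrite lee_fin.
    apply: (@le_trans _ _ (expR (2 ^ s0)%:R * expR (- p s0))).
      by apply: ler_wpM2r; [exact: expR_ge0|exact: pow2_le_expR].
    rewrite -expRD -[X in expR X]opprK; apply: expR_le_geometric.
    rewrite addr0 opprD opprK natrX /v -/Z.
    have : 64 * 2 ^+ s0 <= Z by rewrite /Z ler_wpM2r// ltW// exprn_gt0.
    rewrite -[p s0]/Z; lra.
  set s := (s0 + k)%N.
  pose I1 i := \bigcup_(j in `I_(2 ^ (2 ^ s))) Bad (s, G s.+1 i \- G s j).
  have hI i : measurable (I1 i) /\ (P (I1 i) <= ((2 ^ (2 ^ s))%:R * expR (- p s))%:E)%E.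
    exact: (bigcup_ord_le P (fun j => Bad (s, G s.+1 i \- G s j)) _ _
      (fun j => mBad s _) (fun j => PBad s _)).
  have [mE PE] := bigcup_ord_le P I1 (2 ^ (2 ^ s.+1)) _ (fun i => (hI i).1) (fun i => (hI i).2).
  split; first exact: mE.
  apply: le_trans PE _; rewrite lee_fin.
  apply: (@le_trans _ _ (expR (2 ^ s.+1)%:R * (expR (2 ^ s)%:R * expR (- p s)))).
    apply: ler_pM => //; rewrite ?mulr_ge0 ?expR_ge0 ?pow2_le_expR//.
    by apply: ler_wpM2r; [exact: expR_ge0|exact: pow2_le_expR].
  rewrite -!expRD -[X in expR X]opprK; apply: expR_le_geometric.
  rewrite !natrX exprS.
  have q0 : 64 * 2 ^+ s <= p s by rewrite /p ler_wpM2r// ltW// exprn_gt0.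
  have q1 : Z * (k%:R + 1) <= p s by rewrite /s pE ler_wpM2l//; lra.
  have q2 : 64 * (k%:R + 1) <= Z * (k%:R + 1) by rewrite ler_wpM2r//; have := ler0n R k; lra.
  have q3 : Z * 1 <= Z * (k%:R + 1) by rewrite ler_wpM2l//; have := ler0n R k; lra.
  rewrite -natr1 /v.
  move: q0 q1 q2 q3; set q := 2 ^+ s; set y := Z * _; lra.
have mTl n : measurable (Tl n) /\ (P (Tl n) <= (expR (- v) / 2 ^+ n)%:E)%E.
  split; first exact: mBad.
  apply: le_trans (PBad _ _) _; rewrite lee_fin; apply: expR_le_geometric.
  rewrite pE /v.
  have q1 : Z * (n%:R + 1) <= Z * 2 ^+ n by rewrite ler_wpM2l//; lra.
  have q2 : 64 * n%:R <= Z * n%:R by rewrite ler_wpM2r.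
  move: q1 q2; rewrite mulrDr mulr1; set y := Z * _; have := ler0n R n; lra.
have [mU1 PU1] := bigcup_geometric_le P Ev (expR (- v)) (expR_ge0 _)
  (fun k => (mEv k).1) (fun k => (mEv k).2).
have [mU2 PU2] := bigcup_geometric_le P Tl (expR (- v)) (expR_ge0 _)
  (fun k => (mTl k).1) (fun k => (mTl k).2).
exists (\bigcup_k Ev k `|` \bigcup_k Tl k); split.
- exact: measurableU.
- apply: le_trans (measureU2 P mU1 mU2) _.
  apply: le_trans (leeD PU1 PU2) _.
  by rewrite -EFinD lee_fin -/Z -/v; lra.
move=> t /not_orP[nEv nTl] gt f F'f.
have Ff := F'F _ F'f; have mf := mF f Ff.
pose dn s := ((Num.sqrt (2 ^+ s : R))%:E * fnorm P X (p s) (f \- pi s f)%R)%E.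
have dn0 s : (0 <= dn s)%E by rewrite mule_ge0// lee_fin sqrtr_ge0.
pose in0 := ((Num.sqrt (2 ^+ s0 : R))%:E * fnorm P X (p s0) (pi s0 f))%E.
have in00 : (0 <= in0)%E by rewrite mule_ge0// lee_fin sqrtr_ge0.
have sq0 s : 0 < Num.sqrt (2 ^+ s : R) by rewrite sqrtr_gt0 exprn_gt0.
have chE : chain_sum f = (\sum_(s0 <= s <oo) dn s + in0)%E by [].
have sumdn n : (\sum_(s0 <= s < n) dn s <= \sum_(s0 <= s <oo) dn s)%E.
  by apply: nneseries_lim_ge => s _ _.
have sumoo : (\sum_(s0 <= s <oo) dn s < +oo)%E.
  apply: le_lt_trans (chainoo f Ff); rewrite chE leeDl//.
have in0oo : (in0 < +oo)%E.
  apply: le_lt_trans (chainoo f Ff); rewrite chE leeDr//.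
  by apply: le_trans (sumdn 0%N); rewrite big_geq.
have foo (c : R) (x : \bar R) : 0 < c -> (0 <= x)%E -> (c%:E * x < +oo)%E -> (x < +oo)%E.
  move=> c0 x0; apply: contraTT; rewrite -!leNgt !leye_eq => /eqP ->.
  by rewrite gt0_muley.
have dnoo s : (s0 <= s)%N -> (fnorm P X (p s) (f \- pi s f)%R < +oo)%E.
  move=> s0s; apply: (foo _ _ (sq0 s)) => //.
  apply: le_lt_trans sumoo; apply: le_trans (sumdn s.+1).
  by rewrite big_nat_recr//= leeDr// sume_ge0.
pose r s := fine (fnorm P X (p s) (f \- pi s f)%R).
have rE s : (s0 <= s)%N -> fnorm P X (p s) (f \- pi s f)%R = (r s)%:E.
  by move=> s0s; rewrite /r fineK// ge0_fin_numE// dnoo.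
pose r0 := fine (fnorm P X (p s0) (pi s0 f)).
have r0E : fnorm P X (p s0) (pi s0 f) = r0%:E.
  by rewrite /r0 fineK// ge0_fin_numE//; exact: (foo _ _ (sq0 s0)).
have r_ge0 s : 0 <= r s by exact: fine_ge0.
have dom0 : dom (pi s0 f).
  by apply: (dom_fnorm s0); [exact: mpi|rewrite -/(p s0) r0E ltry].
have mfpi s : measurable_fun setT (f \- pi s f) by apply: measurable_funB => //; exact: mpi.
have domfpi s : (s0 <= s)%N -> dom (f \- pi s f).
  by move=> s0s; apply: (dom_fnorm s) => //; exact: dnoo.
have domf : dom f.
  have -> : f = (f \- pi s0 f) \+ pi s0 f by apply/funext => y /=; rewrite subrK.
  by apply: domD => //; exact: domfpi.
split => //.
have dompi s : (s0 <= s)%N -> dom (pi s f).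
  move=> s0s; have -> : pi s f = f \- (f \- pi s f) by apply/funext => y /=; ring.
  by apply: domB => //; exact: domfpi.
pose S n := \sum_(s0 <= s < s0 + n) Num.sqrt (2 ^+ s) * r s.
have SS n : S n.+1 = S n + Num.sqrt (2 ^+ (s0 + n)) * r (s0 + n)%N.
  by rewrite /S addnS big_nat_recr//= leq_addr.
(* A link costs the distances of [f] to both of its ends. Summation thus yields two copies of [S],
   one of them advanced by a level. *)
have level n : `|W (pi (s0 + n)%N f) t| <= tau * (Num.sqrt (2 ^+ s0) * r0 + (S n.+1 + S n)).
  elim: n => [|n IH].
    have -> : S 0%N = 0 by rewrite /S addn0 big_geq.
    have [i ilt Gi] := hG s0 _ (piP s0 f Ff).1.
    have [_ _ /(_ _ t)] := hBad (s0, G s0 i).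
    rewrite /= Gi => /(_ (mpi s0 f Ff)); rewrite r0E -EFinM lee_fin addn0 => H.
    apply: le_trans (H _ gt) _.
      by move=> bt; apply: nEv; exists 0%N => //; exists i => //; rewrite Gi.
    rewrite -mulrA ler_wpM2l// addr0 lerDl SS.
    by rewrite addr_ge0// ?mulr_ge0// ?sqrtr_ge0// /S addn0 big_geq.
  set s := (s0 + n)%N.
  have [i ilt Gi] := hG s.+1 _ (piP s.+1 f Ff).1.
  have [j jlt Gj] := hG s _ (piP s f Ff).1.
  have [_ _ /(_ _ t)] := hBad (s, G s.+1 i \- G s j).
  rewrite /= Gi Gj => H.
  have {}H : (`|W (pi s.+1 f \- pi s f) t|%:E <=
      (tau * Num.sqrt (2 ^+ s))%:E * fnorm P X (p s) (pi s.+1 f \- pi s f)%R)%E.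
    apply: H => //; first by apply: measurable_funB; exact: mpi.
    move=> bt; apply: nEv; exists n.+1 => //; exists i => //; exists j => //.
    by rewrite -/s Gi Gj.
  have s0s : (s0 <= s)%N by exact: leq_addr.
  have H2 : `|W (pi s.+1 f \- pi s f) t| <= tau * Num.sqrt (2 ^+ s) * (r s.+1 + r s).
    rewrite -lee_fin; apply: le_trans H _; rewrite [leRHS]EFinM; apply: lee_wpmul2l.
      by rewrite lee_fin mulr_ge0// sqrtr_ge0.
    apply: le_trans (fnorm_linkB s f Ff) _.
    by rewrite !rE// leqW.
  rewrite addnS -/s.
  have -> : W (pi s.+1 f) t = W (pi s.+1 f \- pi s f) t + W (pi s f) t.
    by rewrite WB ?subrK//; apply: dompi; rewrite // leqW.
  apply: le_trans (ler_normD _ _) _; apply: le_trans (lerD H2 IH) _.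
  rewrite (SS n.+1) {3}(SS n) addnS -/s -mulrA -mulrDr ler_wpM2l//.
  have : Num.sqrt (2 ^+ s) * r s.+1 <= Num.sqrt (2 ^+ s.+1) * r s.+1 :> R.
    by rewrite ler_wpM2r// ler_wsqrtr// ler_weXn2l// ler1n.
  rewrite mulrDr; lra.
have [n _ En] := hE f F'f.
set s := (s0 + n)%N.
have s0s : (s0 <= s)%N by exact: leq_addr.
have Hf : `|W (f \- pi s f) t| <= tau * Num.sqrt (2 ^+ s) * r s.
  have [_ _ /(_ _ t)] := hBad (s, f \- pi s f).
  rewrite /= rE// -EFinM lee_fin; apply => //.
  by move=> bt; apply: nTl; exists n => //; rewrite /Tl En.
have -> : W f t = W (f \- pi s f) t + W (pi s f) t.
  by rewrite WB ?subrK//; exact: dompi.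
apply: (@le_trans _ _ ((2 * tau)%:E * (S n.+1 + Num.sqrt (2 ^+ s0) * r0)%:E)%E); last first.
  apply: lee_wpmul2l; first by rewrite lee_fin mulr_ge0.
  rewrite chE EFinD; apply: leeD; last by rewrite EFinM -r0E.
  apply: le_trans (sumdn (s0 + n.+1)%N).
  rewrite /S -sumEFin big_nat [leRHS]big_nat; apply: lee_sum => i /andP[s0i _].
  by rewrite EFinM -rE.
rewrite -EFinM lee_fin.
(* The last link costs [S n.+1 - S n], which completes [S n.+1 + S n] to [2 S n.+1]: hence the
   factor 2 in front of [tau]. *)
apply: le_trans (ler_normD _ _) _; apply: le_trans (lerD Hf (level n)) _.
have r00 : 0 <= Num.sqrt (2 ^+ s0) * r0 by rewrite mulr_ge0 ?sqrtr_ge0// fine_ge0.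
rewrite -!mulrA -mulrDr mulrCA ler_wpM2l//.
by move: (SS n); rewrite -/s; lra.
Qed.

End chaining.

(** * The multiplier process *)

Lemma probability_setC_ge {d : measure_display} {T : measurableType d} {R : realType}
    (P : probability T R) (A : set T) (q : R) :
  measurable A -> (P A <= q%:E)%E -> ((1 - q)%:E <= P (~` A))%E.
Proof. by move=> mA PA; rewrite probability_setC// EFinB; apply: leeB. Qed.

(** Continuity from above along the thresholds [y + 1 / (n + 1)]. The exceptional events for
    different [e] come from different admissible sequences and need not be nested, but the sublevel
    sets of [Z] are. *)
Lemma probability_le_right_limit {d : measure_display} {T : measurableType d} {R : realType}
    (P : probability T R) (Z : T -> \bar R) (y c : R) :
  (forall x, measurable [set t | (Z t <= x)%E]) ->
  (forall e, 0 < e -> (c%:E <= P [set t | (Z t <= (y + e)%:E)%E])%E) ->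
  (c%:E <= P [set t | (Z t <= y%:E)%E])%E.
Proof.
move=> mZ H.
pose A n := [set t | (Z t <= (y + n.+1%:R^-1)%:E)%E].
have e0 n : 0 < n.+1%:R^-1 :> R by rewrite invr_gt0 ltr0n.
have AE : \bigcap_n A n = [set t | (Z t <= y%:E)%E].
  apply/seteqP; split => t /= Zt.
    apply/lee_addgt0Pr => e ee.
    have [n _ ne] : exists2 n, True & n.+1%:R^-1 < e.
      exists (Num.truncn e^-1) => //.
      by rewrite invf_plt ?posrE ?ltr0n//; exact: truncnS_gt.
    apply: le_trans (Zt n I) _.
    by rewrite -EFinD lee_fin lerD2l ltW.
  by move=> n _; rewrite /A/=; apply: le_trans Zt _; rewrite lee_fin lerDl ltW.
rewrite -AE.
have cv : P (A n) @[n --> \oo] --> P (\bigcap_n A n).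
  apply: nonincreasing_cvg_mu => //.
  - by apply: le_lt_trans (probability_le1 P (mZ _)) _; exact: ltry.
  - by move=> n; exact: mZ.
  - by rewrite AE; exact: mZ.
  - move=> m n mn; apply/subsetPset => t; rewrite /A/= => /le_trans; apply.
    by rewrite lee_fin lerD2l lef_pV2 ?posrE ?ltr0n// ler_nat ltnS.
rewrite -(cvg_lim _ cv)//; apply: lime_ge; first by apply/cvg_ex; eexists; exact: cv.
by apply: nearW => n; exact: H.
Qed.

Section process.
Context {d : measure_display} {T : measurableType d} {R : realType}.
Context (P : probability T R) {dO : measure_display} {Omega : measurableType dO}.
Context (X : T -> Omega) (xi : T -> R) (N : nat).
Context (Xs : 'I_N -> T -> Omega) (xis : 'I_N -> T -> R).
Context (mX : measurable_fun setT X) (mxi : measurable_fun setT xi).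
Context (mXs : forall i, measurable_fun setT (Xs i)).
Context (mxis : forall i, measurable_fun setT (xis i)).
Context (lawY : forall i,
  same_law P (fun t => (Xs i t, xis i t)) (fun t => (X t, xi t))).

Definition multiplier_process (f : Omega -> R) (t : T) : \bar R :=
  `| \sum_(i < N) ((xis i t * f (Xs i t))%:E - \int[P]_x (xi x * f (X x))%:E) |%E.

Lemma measurable_sup_process (F' : set (Omega -> R)) (y : \bar R) :
  countable F' -> (forall f, F' f -> measurable_fun setT f) ->
  measurable [set t | (ereal_sup [set multiplier_process f t | f in F'] <= y)%E].
Proof.
move=> cF' mF'; have [E hE] := @countable_sub_range _ _ (fun=> 0 : R) cF'.
pose A n := if pselect (F' (E n)) then [set t | (multiplier_process (E n) t <= y)%E] else setT.
suff -> : [set t | (ereal_sup [set multiplier_process f t | f in F'] <= y)%E] = \bigcap_n A n.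
  apply: bigcapT_measurable => n; rewrite /A; case: pselect => /= FE; last exact: measurableT.
  have mp : measurable_fun setT (multiplier_process (E n)).
    apply: measurableT_comp => //; apply: emeasurable_sum => i.
    apply: emeasurable_funB => //; apply/measurable_EFinP; apply: measurable_funM => //.
    by apply: measurableT_comp => //; exact: mF'.
  rewrite (_ : [set t | _] = setT `&` multiplier_process (E n) @^-1` `]-oo, y]%classic).
    by apply: mp => //; exact: emeasurable_itv.
  by apply/seteqP; split => t /=; rewrite in_itv/= => // -[].
apply/seteqP; split => t /= H.
  move=> n _; rewrite /A; case: pselect => //= FE.
  by apply: le_trans H; apply: ereal_sup_ubound; exists (E n).
apply: ub_ereal_sup => _ [f Ff <-]; have [n _ En] := hE f Ff.
by have := H n I; rewrite /A; case: pselect; rewrite En.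
Qed.

Lemma psi2_0_ae : psi2 P xi = 0%E -> P [set t | xi t != 0] = 0%E.
Proof.
move=> psi0.
have xi2 (c : R) : 0 < c -> (\int[P]_t (xi t ^+ (2 * 1))%:E <= (c ^+ 2)%:E)%E.
  move=> c0; have : (psi2 P xi < c%:E)%E by rewrite psi0 lte_fin.
  move=> /ereal_inf_lt[_ [b [b0 hb] <-]]; rewrite lte_fin => bc.
  apply: le_trans (psi2_moment P xi b 1 b0 mxi hb isT) _.
  rewrite lee_fin (_ : 1`!%N = 1%N)// mul1r muln1 lerXn2r ?nnegrE ?ltW//.
have [mB PB] : measurable [set t | xi t != 0] /\
    forall x : R, 0 < x -> (P [set t | (xi t != 0)%R] <= (x ^- 1)%:E)%E.
  have key (x : R) : 0 < x -> measurable [set t | xi t != 0] /\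
      (P [set t | (xi t != 0)%R] <= (x ^- 1)%:E)%E.
    move=> x0.
    (* Markov's inequality with moment bound 0: the event is the same for every [x], while its
       probability is at most [1 / x]. *)
    have -> : [set t | xi t != 0] = [set t | (x * 0 < xi t ^+ 2)%R].
      apply/seteqP; split => t /=; rewrite mulr0.
        by move=> xt; rewrite exprn_even_gt0.
      by apply: contraTneq => ->; rewrite expr0n/= ltxx.
    apply: markov_pow => //; [exact: measurable_funX|by move=> t; exact: sqr_ge0|].
    rewrite expr1; apply/lee_addgt0Pr => e e0; rewrite add0e.
    apply: le_trans (_ : _ <= ((Num.sqrt e) ^+ 2)%:E)%E _; last by rewrite sqr_sqrtr// ltW.
    under eq_integral do rewrite expr1 -[2%N]muln1.
    by apply: xi2; rewrite sqrtr_gt0.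
  by split; [exact: (key 1 ltr01).1|move=> x x0; exact: (key x x0).2].
apply/eqP; rewrite eq_le measure_ge0 andbT; apply/lee_addgt0Pr => e e0; rewrite add0e.
by apply: le_trans (PB e^-1 _) _; rewrite ?invr_gt0// expr1 invrK.
Qed.

(** If the psi_2 norm is 0, the right-hand side of the theorem is 0 even for an infinite [LambdaT],
    so the process itself has to vanish almost surely. It does, since equality in law makes every
    [xis i] vanish almost surely along with [xi]. *)
Lemma psi2_0_process (F' : set (Omega -> R)) :
  psi2 P xi = 0%E -> countable F' -> (forall f, F' f -> measurable_fun setT f) ->
  (1 <= P [set t | (ereal_sup [set multiplier_process f t | f in F'] <= 0)%E])%E.
Proof.
move=> psi0 cF' mF'.
have Pxi := psi2_0_ae psi0.
have mxi0 (g : T -> R) : measurable_fun setT g -> measurable [set t | g t != 0].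
  move=> mg; rewrite (_ : [set t | _] = setT `&` g @^-1` (~` [set 0])).
    by apply: mg => //; exact: measurableC.
  by apply/seteqP; split => t /=; [move=> /eqP|move=> [_ /eqP]].
have I0 f : F' f -> (\int[P]_x (xi x * f (X x))%:E = 0)%E.
  move=> Ff; rewrite (@ae_eq_integral _ _ _ P setT (cst 0%E))//.
  - by rewrite integral0.
  - apply/measurable_EFinP; apply: measurable_funM => //.
    by apply: measurableT_comp => //; exact: mF'.
  - exists [set t | xi t != 0]; split => //; first exact: mxi0.
    move=> t /= H; apply: contra_notN H => /eqP -> _; by rewrite mul0r.
have Pi (i : 'I_N) : P [set t | xis i t != 0] = 0%E.
  have := lawY i (setT `*` ~` [set 0]).
  rewrite (_ : _ @^-1` _ = [set t | xis i t != 0]).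
    rewrite (_ : _ @^-1` _ = [set t | xi t != 0]) ?Pxi.
      by apply; apply: measurableX => //; exact: measurableC.
    by apply/seteqP; split => t /=; [move=> [_ /eqP]|move=> /eqP].
  by apply/seteqP; split => t /=; [move=> [_ /eqP]|move=> /eqP].
pose B := \big[setU/set0]_(i < N) [set t | xis i t != 0].
have [mB PB] : measurable B /\ P B = 0%E.
  apply: (big_ind (fun S => measurable S /\ P S = 0%E)).
  - by rewrite measure0.
  - move=> S1 S2 [m1 P1] [m2 P2]; split; first exact: measurableU.
    apply/eqP; rewrite eq_le measure_ge0 andbT.
    by apply: le_trans (measureU2 P m1 m2) _; rewrite [X in (X + _)%E]P1 [X in (_ + X)%E]P2 adde0.
  - by move=> i _; split; [exact: mxi0|exact: Pi].
apply: (@le_trans _ _ (P (~` B))); first by rewrite probability_setC// PB sube0.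
apply: le_measure; rewrite ?inE; first exact: measurableC.
  exact: measurable_sup_process.
move=> t /= nB; apply: ub_ereal_sup => _ [f Ff <-].
rewrite /multiplier_process I0// big1 ?abse0// => i _.
have [->|xn0] := eqVneq (xis i t) 0; first by rewrite mul0r sube0.
by exfalso; apply: nB; rewrite /B (bigD1 i)//=; left.
Qed.

Context (indY : mutually_independent P (fun i t => (Xs i t, xis i t))).
Context (K u w : R) (s0 : nat) (F F' : set (Omega -> R)).
Context (K0 : 0 < K) (N0 : (0 < N)%N).
Context (xiK : (\int[P]_t (expR ((`|xi t| / K) ^+ 2))%:E <= 2%:E)%E).
Context (mF : forall f, F f -> measurable_fun setT f) (u8 : 8 <= u) (w8 : 8 <= w).
Context (F'F : F' `<=` F) (cF' : countable F').

Lemma multiplier_process_tail Fs pi (M : \bar R) :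
  admissible_with_proj P X u F Fs pi ->
  (forall f, F f -> (chain_sum P X u s0 pi f <= M)%E) -> (M < +oo)%E ->
  ((1 - 2 * expR (- (1 / 8) * u ^+ 2 * 2 ^+ s0) - 2 * expR (- (1 / 8) * N%:R * w ^+ 2))%:E
   <= P [set t | (ereal_sup [set multiplier_process f t | f in F'] <=
        (46 * expR 1 ^+ 6 * u * w * Num.sqrt N%:R * K)%:E * M)%E])%E.
Proof.
move=> adm chM Moo.
have u8' := u8; have w8' := w8.
have w1 : 1 <= w by lra.
have u64 : 64 <= u ^+ 2 by nra.
have p64 s : 64 <= u ^+ 2 * 2 ^+ s.
  by have : 1 <= 2 ^+ s :> R by [apply: exprn_ege1; rewrite ler1n]; nra.
have [A [mA PA HA]] := multiplier_sq_tail P X xi N Xs xis K mX mxi mXs mxis indY lawY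
  K0 N0 xiK w w1.
pose dom := [set h : Omega -> R | P.-integrable setT (fun t => (xi t * h (X t))%:E)].
pose W (h : Omega -> R) t := \sum_i xis i t * h (Xs i t) - N%:R * \int[P]_x (xi x * h (X x)).
(* The square root of [p = u^2 2^s] splits: [u] joins [tau], and [sqrt (2^s)] stays as the weight of
   the level. *)
pose tau : R := 23 * expR 1 ^+ 6 * w * Num.sqrt N%:R * u * K.
have tau0 : 0 <= tau.
  by rewrite !mulr_ge0 ?sqrtr_ge0 ?exprn_ge0 ?expR_ge0 ?ler0n//; [lra|lra|exact: ltW].
have [||a b t ia ib|s h mh hoo|s h mh||B [mB PB HB]] := chaining P X u s0 F Fs pi mX u8 mF adm
  W dom [set t | \sum_i xis i t ^+ 2 <= 32 * expR 1 * N%:R * w ^+ 2 * K ^+ 2] tau tau0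
  _ _ _ _ _ F' F'F cF'.
- move=> a b ia ib; rewrite /dom/=.
  by under eq_fun do rewrite mulrDr EFinD; exact: integrableD.
- move=> a b ia ib; rewrite /dom/=.
  by under eq_fun do rewrite mulrBr EFinB; exact: integrableB.
- rewrite /W.
  under eq_bigr do rewrite mulrBr; under eq_Rintegral do rewrite mulrBr.
  by rewrite sumrB RintegralB//; ring.
- have n0 : (0 <= fnorm P X (u ^+ 2 * 2 ^+ s) h)%E.
    by apply: pnorm_ge0; apply: le_trans (p64 s); rewrite ler1n.
  apply: (multiplier_integrable P X xi K mX mxi K0 xiK h (u ^+ 2 * 2 ^+ s)
    (fine (fnorm P X (u ^+ 2 * 2 ^+ s) h)) mh (p64 s) (fine_ge0 n0)).
  by rewrite fineK// ge0_fin_numE.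
- have [B [mB PB HB]] := multiplier_link P X xi N Xs xis K mX mxi mXs mxis indY lawY
    K0 N0 xiK h (u ^+ 2 * 2 ^+ s) w mh (p64 s) w1.
  exists B; split => // t Bt gt; apply: le_trans (HB t Bt gt) _.
  rewrite le_eqVlt; apply/orP; left; apply/eqP; congr (_%:E * _)%E.
  by rewrite sqrtrM ?sqr_ge0// sqrtr_sqr ger0_norm; [rewrite /tau; ring|lra].
- by move=> f Ff; apply: le_lt_trans (chM f Ff) Moo.
have mAB : measurable (A `|` B) by exact: measurableU.
have Z64 := p64 s0.
have PAB : (P (A `|` B) <= (expR (- (N%:R * w ^+ 2)) +
    4 * expR (- (u ^+ 2 * 2 ^+ s0 / 4)))%:E)%E.
  by apply: le_trans (measureU2 P mA mB) _; rewrite EFinD; apply: leeD.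
apply: (@le_trans _ _ (P (~` (A `|` B)))).
  apply: le_trans (probability_setC_ge P _ _ mAB PAB); rewrite lee_fin.
  have h1 : expR (- (N%:R * w ^+ 2)) <= 2 * expR (- (1 / 8) * N%:R * w ^+ 2).
    have : expR (- (N%:R * w ^+ 2)) <= expR (- (1 / 8) * N%:R * w ^+ 2).
      by rewrite ler_expR; have : 0 <= N%:R * w ^+ 2 by [rewrite mulr_ge0// sqr_ge0]; lra.
    by have := expR_ge0 (- (1 / 8) * N%:R * w ^+ 2); lra.
  (* Half of the exponent is spent on lowering the prefactor from 4 to 2; this is the origin of the
     constant [1 / 8]. *)
  have h2 : 4 * expR (- (u ^+ 2 * 2 ^+ s0 / 4)) <= 2 * expR (- (1 / 8) * u ^+ 2 * 2 ^+ s0).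
    set y := u ^+ 2 * 2 ^+ s0 in Z64 *.
    have -> : - (1 / 8) * u ^+ 2 * 2 ^+ s0 = - (y / 8) by rewrite /y; field.
    have -> : - (y / 4) = - (y / 8) - y / 8 by field.
    rewrite expRD.
    have := expR_gt0 (- (y / 8)).
    have : 2 * expR (- (y / 8)) <= 1.
      rewrite expRN -ler_pdivlMr ?invr_gt0 ?expR_gt0// invrK mul1r.
      by have := expR_ge1Dx (y / 8); lra.
    nra.
  lra.
apply: le_measure; rewrite ?inE; first exact: measurableC.
  by apply: measurable_sup_process => // f /F'F; exact: mF.
move=> t /= /not_orP[nA nB]; apply: ub_ereal_sup => _ [f F'f <-].
have [domf Wf] := HB t nB (HA t nA) f F'f.
have fin := integrable_fin_num measurableT domf.
have -> : multiplier_process f t = (`|W f t|%:E)%E.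
  rewrite /multiplier_process -(fineK fin).
  under eq_bigr do rewrite -EFinB.
  rewrite sumEFin abse_EFin sumrB sumr_const card_ord /W.
  by rewrite -[fine _ *+ N]mulr_natl.
apply: le_trans Wf _.
have -> : 46 * expR 1 ^+ 6 * u * w * Num.sqrt N%:R * K = 2 * tau by rewrite /tau; ring.
by apply: lee_wpmul2l; [rewrite lee_fin mulr_ge0|exact/chM/F'F].
Qed.

End process.

Theorem mainTheorem13 (R : realType) :
  exists c1 c2 : R, 0 < c1 /\ 0 < c2 /\
  forall (d : measure_display) (T : measurableType d) (P : probability T R)
    (dO : measure_display) (Omega : measurableType dO)
    (X : T -> Omega) (xi : T -> R) (N : nat)
    (Xs : 'I_N -> T -> Omega) (xis : 'I_N -> T -> R)
    (F : set (Omega -> R)) (s0 : nat) (u w : R),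
    measurable_fun setT X -> measurable_fun setT xi ->
    (psi2 P xi < +oo)%E ->
    (forall i, measurable_fun setT (Xs i)) ->
    (forall i, measurable_fun setT (xis i)) ->
    mutually_independent P (fun i t => (Xs i t, xis i t)) ->
    (forall i, same_law P (fun t => (Xs i t, xis i t)) (fun t => (X t, xi t))) ->
    (forall f, F f -> measurable_fun setT f) ->
    8 <= u -> 8 <= w ->
    forall F' : set (Omega -> R), F' `<=` F -> countable F' ->
    ((1 - 2 * expR (- c1 * u ^+ 2 * 2 ^+ s0) - 2 * expR (- c1 * N%:R * w ^+ 2))%:E
     <= P [set t | (ereal_sup
            [set `| \sum_(i < N) ((xis i t * f (Xs i t))%:E
                                   - \int[P]_x (xi x * f (X x))%:E) |
             | f in F']
          <= (c2 * u * w * Num.sqrt N%:R)%:E * psi2 P xi * LambdaT P X s0 u F)%E])%E.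
Proof.
(* [92 = 23 * 2 * 2]: the constant of one link, the factor 2 of chaining, and the loss in replacing
   the psi_2 norm by an admissible [K]. *)
exists (1 / 8), (92 * expR 1 ^+ 6); split; first by rewrite divr_gt0.
split; first by rewrite mulr_gt0// exprn_gt0// expR_gt0.
move=> d T P dO Omega X xi N Xs xis F s0 u w mX mxi psioo mXs mxis indY lawY mF u8 w8
  F' F'F cF'.
set c2 := 92 * expR 1 ^+ 6; set q := (1 - _ - _).
have q1 : (q%:E <= 1)%E.
  rewrite lee_fin /q.
  have := expR_ge0 (- (1 / 8) * u ^+ 2 * 2 ^+ s0).
  by have := expR_ge0 (- (1 / 8) * N%:R * w ^+ 2); lra.
have mF' f : F' f -> measurable_fun setT f by move=> /F'F; exact: mF.
have mS y := measurable_sup_process P X xi N Xs xis mXs mxis F' y cF' mF'.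
set rhs := (_ * _ * _)%E.
change (q%:E <= P [set t | (ereal_sup [set multiplier_process P X xi N Xs xis f t | f in F']
  <= rhs)%E])%E.
have trivial_case : (forall t, (ereal_sup [set multiplier_process P X xi N Xs xis f t | f in F']
  <= rhs)%E) -> (q%:E <= P [set t | (ereal_sup [set multiplier_process P X xi N Xs xis f t | f in F']
  <= rhs)%E])%E.
  move=> H; rewrite (_ : [set t | _] = setT); first by rewrite (probability_setT P).
  by apply/seteqP; split => // t _ /=; exact: H.
have [N0|N0] := posnP N.
  apply: trivial_case => t; rewrite /rhs.
  have -> : Num.sqrt N%:R = 0 :> R by rewrite N0 sqrtr0.
  rewrite mulr0 !mul0e; apply: ub_ereal_sup => _ [f _ <-].
  rewrite /multiplier_process big1 ?abse0// => i _.
  by have := leq_trans (ltn_ord i) (eq_leq N0); rewrite ltn0.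
have psi0 : (0 <= psi2 P xi)%E by apply: le_ereal_inf_tmp => _ [c [c0 _] <-]; rewrite lee_fin ltW.
have psifin : psi2 P xi \is a fin_num by rewrite ge0_fin_numE.
have [psiE0|psin0] := eqVneq (psi2 P xi) 0%E.
  have -> : rhs = 0%E by rewrite /rhs psiE0 mule0 mul0e.
  apply: le_trans q1 _.
  exact: (psi2_0_process P X xi N Xs xis mX mxi mXs mxis lawY F' psiE0 cF' mF').
pose psi := fine (psi2 P xi).
have psiE : psi2 P xi = psi%:E by rewrite fineK.
have psi_gt0 : 0 < psi by rewrite fine_gt0// lt0e psin0 psi0/= psioo.
pose C := c2 * u * w * Num.sqrt N%:R * psi.
have C0 : 0 < C.
  by rewrite !mulr_gt0// ?sqrtr_gt0 ?ltr0n ?exprn_gt0 ?expR_gt0//; lra.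
have rhsE : rhs = (C%:E * LambdaT P X s0 u F)%E by rewrite /rhs psiE -EFinM.
(* An empty [F] falls under this case: it has no admissible sequence, as the first net must contain
   a point of [F]. *)
have [Loo|Loo] := eqVneq (LambdaT P X s0 u F) +oo%E.
  by apply: trivial_case => t; rewrite rhsE Loo gt0_muley ?lte_fin// leey.
have L0 : (0 <= LambdaT P X s0 u F)%E.
  apply: le_ereal_inf_tmp => _ [Fs [pi [adm ->]]].
  have [FsF [[f0 Fs0] _]] := adm.
  have Ff0 : F f0 by apply: (FsF 0%N); rewrite Fs0.
  apply: le_trans (ereal_sup_ubound _); last by exists f0.
  have n0 s h : (0 <= fnorm P X (u ^+ 2 * 2 ^+ s) h)%E.
    apply: pnorm_ge0; rewrite mulr_ege1// exprn_ege1//; lra.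
  apply: adde_ge0; last by rewrite mule_ge0// lee_fin sqrtr_ge0.
  by apply: nneseries_ge0 => s _ _; rewrite mule_ge0// lee_fin sqrtr_ge0.
pose L := fine (LambdaT P X s0 u F).
have LE : LambdaT P X s0 u F = L%:E by rewrite fineK// ge0_fin_numE// lt_neqAle Loo leey.
(* The psi_2 norm is an infimum; any [K] that satisfies the exponential condition and is at most
   twice the norm will do. *)
have [K [K0 xiK K2]] : exists K, [/\ 0 < K,
    (\int[P]_t (expR ((`|xi t| / K) ^+ 2))%:E <= 2%:E)%E & K <= 2 * psi].
  have : (psi2 P xi < (2 * psi)%:E)%E by rewrite psiE lte_fin; lra.
  move=> /ereal_inf_lt[_ [K [K0 xiK] <-]]; rewrite lte_fin => /ltW K2.
  by exists K.
rewrite rhsE LE -EFinM; apply: probability_le_right_limit => [y|e e0]; first exact: mS.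
(* The margin [e / C] becomes exactly [e] after multiplication by [C]. *)
have : (LambdaT P X s0 u F < (L + e / C)%:E)%E by rewrite LE lte_fin ltrDl divr_gt0.
move=> /ereal_inf_lt[M [Fs [pi [adm ME]]] ML].
have chM f : F f -> (chain_sum P X u s0 pi f <= M)%E.
  by move=> Ff; rewrite ME; apply: ereal_sup_ubound; exists f.
have Moo : (M < +oo)%E by apply: lt_trans ML _; rewrite ltry.
have M0 : (0 <= M)%E.
  apply: le_trans L0 _; apply: ereal_inf_lbound; exists Fs, pi; split => //.
have := multiplier_process_tail P X xi N Xs xis mX mxi mXs mxis lawY indY K u w s0 F F'
  K0 N0 xiK mF u8 w8 F'F cF' Fs pi M adm chM Moo.
move=> /le_trans; apply.
apply: le_measure; rewrite ?inE; [exact: mS|exact: mS|].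
move=> t /= /le_trans; apply.
apply: (@le_trans _ _ (C%:E * M)%E).
  apply: lee_wpmul2r => //; rewrite lee_fin /C /c2.
  have -> : 92 * expR 1 ^+ 6 * u * w * Num.sqrt N%:R * psi =
    (46 * expR 1 ^+ 6 * u * w * Num.sqrt N%:R) * (2 * psi) by ring.
  apply: ler_wpM2l => //.
  by rewrite !mulr_ge0 ?sqrtr_ge0 ?exprn_ge0 ?expR_ge0 ?ler0n//; lra.
apply: (@le_trans _ _ (C%:E * (L + e / C)%:E)%E).
  by apply: lee_wpmul2l; [rewrite lee_fin ltW|exact: ltW].
rewrite -EFinM lee_fin le_eqVlt; apply/orP; left; apply/eqP; field.
by rewrite gt_eqF.
Qed.
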